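(* Let $G$ be an infinite locally finite group in $\mathfrak{Y}_n$. Then $G$ is metabelian.
   Context: $\mathfrak{Y}_n$ denotes the class of all groups $G$ (finite or infinite) such that $N_G(A)=A$ for every non-abelian subgroup $A\le G$. A group is locally finite if every finitely generated subgroup is finite; metabelian means the derived subgroup is abelian. *)

(* Defs.v *)
From Stdlib Require Import List.
Import ListNotations.

Record Group := {
  carrier :> Type;
  gmul : carrier -> carrier -> carrier;
  gone : carrier;
  ginv : carrier -> carrier;
  gmul_assoc : forall x y z, gmul x (gmul y z) = gmul (gmul x y) z;
  gmul_1l : forall x, gmul gone x = x;
  gmul_Vl : forall x, gmul (ginv x) x = gone
}.

Arguments gmul {g}.
Arguments gone {g}.
Arguments ginv {g}.

Definition is_subgroup (G : Group) (A : G -> Prop) : Prop :=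
  A gone /\ (forall x y, A x -> A y -> A (gmul x y)) /\ (forall x, A x -> A (ginv x)).

Definition gen_set (G : Group) (S : G -> Prop) : G -> Prop :=
  fun x => forall H, is_subgroup G H -> (forall y, S y -> H y) -> H x.

Definition finite_set (G : Group) (A : G -> Prop) : Prop :=
  exists l : list G, forall x, A x -> In x l.

Definition infinite_group (G : Group) : Prop := ~ finite_set G (fun _ => True).

Definition locally_finite (G : Group) : Prop :=
  forall s : list G, finite_set G (gen_set G (fun x => In x s)).

Definition abelian_set (G : Group) (A : G -> Prop) : Prop :=
  forall x y, A x -> A y -> gmul x y = gmul y x.

Definition normalizes (G : Group) (g : G) (A : G -> Prop) : Prop :=
  forall x, A x <-> A (gmul (ginv g) (gmul x g)).

Definition self_normalizing (G : Group) (A : G -> Prop) : Prop :=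
  forall g, normalizes G g A <-> A g.

Definition in_Yn (G : Group) : Prop :=
  forall A, is_subgroup G A -> ~ abelian_set G A -> self_normalizing G A.

Definition commutator (G : Group) (x y : G) : G :=
  gmul (ginv x) (gmul (ginv y) (gmul x y)).

Definition derived_subgroup (G : Group) : G -> Prop :=
  gen_set G (fun z => exists x y, z = commutator G x y).

Definition metabelian (G : Group) : Prop := abelian_set G (derived_subgroup G).

(* Main.v *)
(** In a group of the class, a nonabelian normal subgroup of a subgroup H is all
    of H, so every subgroup is metabelian or perfect.  The heart of the matter is
    finite: a finite nonmetabelian group F of the class has no proper
    nonmetabelian subgroup.  In an infinite locally finite nonmetabelian group one
    could add one element to a finite nonmetabelian subgroup, a contradiction.

    A metabelian nonabelian finite group of the class is a p-group or B : <x>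
    with B an abelian normal p'-subgroup, x a p-element, C_B(x) = 1 and x^p
    central.  With transfer this shows that F is simple, that its centralizers of
    nontrivial elements are abelian (so they are TI subgroups partitioning F),
    and that each of them has prime index in its normalizer.

    Odd order is excluded by characters, as in Suzuki's theorem on CA-groups.
    For a centralizer A put a = |A|, w = |N(A) : A|.  The characters induced from
    lambda - lambda^* have norm 2, hence equal chi - chi^*; this attaches to A a
    set I_A of (a - 1) / w irreducible characters.  For A, A' not conjugate a
    parity argument shows that all of I_A is nonzero on A' or all of I_A' is
    nonzero on A; for A of minimal order, norm computations and column
    orthogonality then bound |F| by less than |F|.

    If F has an involution t and A = C(t), counting involutions in the cosets of
    N(A) gives |F : N(A)| = |A| + 1, and counting pairs (d, s) where the
    involution s inverts d gives |A| = p + 1 with p = |N(A) : A|.  So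
    |F| = p (p + 1) (p + 2).  The prime p is the same for a nonmetabelian
    subgroup containing t, which therefore has the order of F. *)

From HB Require Import structures.
From Stdlib Require List.
From mathcomp Require Import all_boot all_order all_algebra all_fingroup.
From mathcomp Require Import all_solvable all_field all_character.
From mathcomp Require Import ring lra zify.
Require Import Defs.

Set Implicit Arguments.
Unset Strict Implicit.
Unset Printing Implicit Defensive.

Import Order.TTheory GRing.Theory Num.Theory FiniteModule.

(** * Integer-valued functions on a finite set *)

(** Here [a] is |A|, [w] is |N : A|, and [q], [r] count [real_nonconst] and [nonreal_on]. As r w >=
    a - 1, dividing by a - 1 leaves q + (a - w) + 1 <= a. *)
Lemma nonconst_arith a w q r : 0 < w -> 2 * w < a ->
  q * a.-1 + r * (w * (a - w)) + a.-1 <= a.-1 * a -> a.-1 <= r * w -> q < w.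
Proof.
move=> w0 dw le1 le2; rewrite ltnNge; apply/negP=> le4.
have : a.-1 * (a - w) <= r * w * (a - w) by rewrite leq_mul2r le2 orbT.
have : w * a.-1 <= q * a.-1 by rewrite leq_mul2r le4 orbT.
have : w * a.-1 + a.-1 * (a - w) = a.-1 * a.
  by rewrite [w * _]mulnC -mulnDr subnKC //; lia.
move: le1; rewrite -!mulnA; lia.
Qed.

Section IntegerSpread.
Local Open Scope ring_scope.

Lemma sum_sqr_bound (I : finType) (R : {set I}) (x : I -> int) :
  (\sum_(i in R) x i) ^+ 2 <= #|R|%:R * \sum_(i in R) x i ^+ 2.
Proof.
have: 0 <= \sum_(i in R) \sum_(j in R) (x i - x j) ^+ 2.
  by apply: sumr_ge0 => i _; apply: sumr_ge0 => j _; exact: sqr_ge0.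
have -> : \sum_(i in R) \sum_(j in R) (x i - x j) ^+ 2
  = (#|R|%:R * \sum_(i in R) x i ^+ 2) *+ 2 - (\sum_(i in R) x i) ^+ 2 *+ 2.
  under eq_bigr => i _ do under eq_bigr => j _ do rewrite sqrrB.
  under eq_bigr => i _ do rewrite big_split sumrB /= sumr_const sumrMnl -mulr_sumr.
  rewrite big_split sumrB /= sumr_const !sumrMnl -mulr_suml -[_ *+ #|R|]mulr_natl.
  set S := \sum_(i in R) x i; set T := \sum_(i in R) x i ^+ 2; ring.
lia.
Qed.

Lemma int_le_sqr (y : int) : y <= y ^+ 2.
Proof.
have [y0|y0] := lerP y 0; first exact: le_trans y0 (sqr_ge0 y).
by rewrite expr2 ler_peMr ?(ltW y0) // -gtz0_ge1.
Qed.

Lemma int_sqr_ge1 (y : int) : y != 0 -> 1 <= y ^+ 2.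
Proof. by move=> y0; rewrite -gtz0_ge1 exprn_even_gt0. Qed.

Variables (I : finType) (x : I -> int).
Let V := #|I|%:R * (\sum_i x i ^+ 2) - (\sum_i x i) ^+ 2.

Lemma spread_shift c :
  V = #|I|%:R * (\sum_i (x i - c) ^+ 2) - (\sum_i (x i - c)) ^+ 2.
Proof.
rewrite /V.
under [X in _ = _ * X - _]eq_bigr => i _ do rewrite sqrrB.
rewrite big_split !sumrB /= !sumr_const sumrMnl -mulr_suml.
rewrite -[_ *+ #|xpredT|]mulr_natl -[_ *+ #|xpredT|]mulr_natl.
set S := \sum_i x i; set T := \sum_i _.
by rewrite (_ : #|xpredT| = #|I|) //; ring.
Qed.

(** Shift by x i and let t values become nonzero. Cauchy-Schwarz on these gives V >= (n - t) t with
    n = #|I|, and 1 <= t <= n - 1. *)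
Lemma spread_nonconst i j : x i != x j -> #|I|%:R - 1 <= V.
Proof.
move=> nij; rewrite (spread_shift (x i)).
pose T := [set k | x k != x i].
have sumT (F : I -> int) : (forall k, x k = x i -> F k = 0) ->
    \sum_k F k = \sum_(k in T) F k.
  move=> F0; rewrite [RHS]big_mkcond; apply: eq_bigr => k _; rewrite inE.
  by case: eqP => //= /F0.
rewrite !sumT => [|k ->|k ->]; rewrite ?subrr ?expr0n //.
set S2 := \sum_(k in T) _ ^+ 2.
have leS := sum_sqr_bound T (fun k => x k - x i).
have T1 : (0 < #|T|)%N by apply/card_gt0P; exists j; rewrite inE eq_sym.
have TI : (#|T| < #|I|)%N.
  rewrite -cardsT; apply: proper_card; apply/properP; split; first exact: subsetT.
  by exists i; rewrite ?inE ?eqxx.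
have leT : #|T|%:R <= S2.
  rewrite -sum1_card natr_sum; apply: ler_sum => k; rewrite inE -subr_eq0.
  exact: int_sqr_ge1.
have : (#|I|%:R - #|T|%:R) * #|T|%:R <= (#|I|%:R - #|T|%:R) * S2 :> int.
  by apply: ler_wpM2l => //; lia.
have : 0 <= (#|T|%:R - 1) * (#|I|%:R - #|T|%:R - 1) :> int.
  by apply: mulr_ge0; lia.
move: leS; rewrite -/S2; move: (S2) (_ ^+ 2) (#|T|%:R : int) => s s' t; lra.
Qed.

(** Shift by u. With r indices outside both sets and sums S1, S2 over them, V is (2 w + r) (w + S2)
    - (w + S1)^2; now S1^2 <= r S2, and S1 <= S2 for integers. *)
Lemma spread_pair (O O' : {set I}) u w : [disjoint O & O'] ->
  #|O| = w -> #|O'| = w ->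
  {in O, forall i, x i = u + 1} -> {in O', forall i, x i = u} ->
  w%:R * (#|I|%:R - w%:R) <= V.
Proof.
move=> dO cO cO' xO xO'; rewrite (spread_shift u).
pose R := ~: (O :|: O').
have splitI (F : I -> int) :
    \sum_k F k = \sum_(k in O) F k + \sum_(k in O') F k + \sum_(k in R) F k.
  rewrite (bigID (mem O)) /= [X in _ + X](bigID (mem O')) /= addrA; congr (_ + _ + _).
    apply: eq_bigl => k; have [kO'|] := boolP (k \in O'); last by rewrite andbF.
    by rewrite andbT; apply: contraL kO' => kO; rewrite (disjointFr dO kO).
  by apply: eq_bigl => k; rewrite !inE negb_or.
have cR : (#|I| = w + w + #|R|)%N.
  by rewrite -(cardsC (O :|: O')) cardsU (disjoint_setI0 dO) cards0 subn0 cO cO'.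
rewrite !splitI.
have sO1 : \sum_(k in O) (x k - u) = w%:R.
  rewrite -cO -sum1_card natr_sum; apply: eq_bigr => k /xO ->.
  by rewrite addrAC subrr add0r.
have sO2 : \sum_(k in O) (x k - u) ^+ 2 = w%:R.
  by rewrite -sO1; apply: eq_bigr => k /xO ->; rewrite addrAC subrr add0r.
have sO'1 : \sum_(k in O') (x k - u) = 0.
  by apply: big1 => k /xO' ->; rewrite subrr.
have sO'2 : \sum_(k in O') (x k - u) ^+ 2 = 0.
  by apply: big1 => k /xO' ->; rewrite subrr expr0n.
rewrite sO1 sO2 sO'1 sO'2 !addr0.
set S2 := \sum_(k in R) _ ^+ 2; set S1 := \sum_(k in R) _.
have leS : S1 ^+ 2 <= #|R|%:R * S2 := sum_sqr_bound R _.
have S12 : S1 <= S2 by apply: ler_sum => k _; exact: int_le_sqr.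
rewrite cR !natrD.
have : 0 <= w%:R * (S2 - S1) by rewrite mulr_ge0 // subr_ge0.
move: leS; move: S1 S2 (#|R|%:R : int) (w%:R : int) {S12} => S1 S2 r w'; lra.
Qed.

End IntegerSpread.

(** * Induction from a self-centralising TI subgroup in a group of odd order *)

Local Open Scope group_scope.

Definition CA_subgroup (gT : finGroupType) (G A : {group gT}) :=
  [/\ abelian A, normedTI A^# G 'N_G(A) & {in A^#, forall a, 'C_G[a] = A}].

Section TIInduction.

Variables (gT : finGroupType) (G A : {group gT}).
Let N := 'N_G(A)%G.

Hypothesis oddG : odd #|G|.
Hypothesis caA : CA_subgroup G A.
Let abA : abelian A. Proof. by case: caA. Qed.
Let tiA : normedTI A^# G N. Proof. by case: caA. Qed.
Let centA : {in A^#, forall a, 'C_G[a] = A}. Proof. by case: caA. Qed.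

Let sAG : A \subset G.
Proof.
have /andP[/set0Pn[a Aa] _] := tiA.
by rewrite -(centA Aa) subsetIl.
Qed.
Let nsAN : A <| N. Proof. exact: normalSG. Qed.
Let sNG : N \subset G. Proof. exact: subsetIl. Qed.
Let nAN n : n \in N -> n \in 'N(A). Proof. by case/setIP. Qed.

Local Open Scope ring_scope.

(** A conjugator outside N moves every element of A^# out of A, so only N contributes to the induced
    function. *)
Lemma Res_Ind_TI (beta : 'CF(A)) : beta 1%g = 0 ->
  'Res[A] ('Ind[G] beta) = #|A|%:R^-1 *: \sum_(n in N) (beta ^ n)%CF.
Proof.
move=> beta1; apply/cfun_inP=> x Ax.
rewrite cfResE // cfIndE // cfunE sum_cfunE; congr (_ * _).
rewrite (reindex_inj invg_inj) /= [RHS]big_mkcond [LHS]big_mkcond.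
apply: eq_bigr => y _; rewrite groupV.
case: ifP => Gy; last first.
  by case: ifP => // /(subsetP sNG); rewrite Gy.
have [-> | x1] := eqVneq x 1%g.
  by rewrite conj1g beta1; case: ifP => // Ny; rewrite cfConjg1.
have A1x : x \in A^# by rewrite !inE x1.
have [_ _ memJ] := normedTI_memJ_P tiA.
case: ifP => Ny; first by rewrite cfConjgE ?nAN.
rewrite cfun0 //; apply: contraFN Ny => Axy.
rewrite -groupV -(memJ x) ?groupV // in_setD1 Axy andbT.
by rewrite conjg_eq1.
Qed.

(** It vanishes at 1, so the induced [Dpsi] is supported on the conjugates of A^#. *)
Definition dpsi (i : Iirr A) : 'CF(A) := 'chi_i - ('chi_i)^*%CF.
Definition Dpsi (i : Iirr A) : 'CF(G) := 'Ind[G] (dpsi i).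

Lemma dpsi1 i : dpsi i 1%g = 0.
Proof.
by rewrite /dpsi -conjC_IirrE !cfunE !lin_char1 ?subrr //; apply/char_abelianP.
Qed.

Lemma dpsi_conjC i : dpsi (conjC_Iirr i) = - dpsi i.
Proof. by rewrite /dpsi conjC_IirrE cfConjCK opprB. Qed.

Lemma Dpsi_conjC i : Dpsi (conjC_Iirr i) = - Dpsi i.
Proof. by rewrite /Dpsi dpsi_conjC raddfN. Qed.

Lemma dpsiJ i n : (dpsi i ^ n)%CF = dpsi (conjg_Iirr i n).
Proof. by rewrite /dpsi conjg_IirrE conj_cfConjg raddfB. Qed.

Lemma DpsiJ i n : n \in N -> Dpsi (conjg_Iirr i n) = Dpsi i.
Proof.
move=> Nn; rewrite /Dpsi -dpsiJ.
apply/cfun_inP=> x Gx; rewrite !cfIndE //; congr (_ * _).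
rewrite (reindex_acts 'R _ (subsetP sNG _ Nn)) ?astabsR //=.
apply: eq_bigr => z Gz; rewrite conjgM cfConjgEJ ?nAN //.
Qed.

Lemma cfdot_dpsi i j :
  '[dpsi i, dpsi j] = 2 * ((i == j)%:R - (conjC_Iirr i == j)%:R).
Proof.
have conjE k l : (k == conjC_Iirr l) = (conjC_Iirr k == l) :> bool.
  by apply/eqP/eqP=> [->|<-]; rewrite conjC_IirrK.
rewrite /dpsi -!conjC_IirrE cfdotBl !cfdotBr !cfdot_irr.
by rewrite conjE (inj_eq (can_inj (@conjC_IirrK _ _))); ring.
Qed.

Lemma cfdot_Dpsi i j :
  '[Dpsi i, Dpsi j] = #|A|%:R^-1 * \sum_(n in N)
     (2 * ((i == conjg_Iirr j n)%:R - (conjC_Iirr i == conjg_Iirr j n)%:R)).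
Proof.
rewrite -Frobenius_reciprocity Res_Ind_TI ?dpsi1 // cfdotZr.
rewrite fmorphV rmorph_nat; congr (_ * _).
by rewrite cfdot_sumr; apply: eq_bigr => n _; rewrite dpsiJ cfdot_dpsi.
Qed.

Lemma odd_sqr_root n : n \in G -> ((n ^+ 2) ^+ #[n].+1./2)%g = n.
Proof.
move=> Gn; have on : odd #[n] by apply: dvdn_odd oddG; exact: order_dvdG.
by rewrite -expgM mul2n even_halfK /= ?on // expgS expg_order mulg1.
Qed.

Lemma sqr_mem_odd n : n \in G -> (n ^+ 2)%g \in A -> n \in A.
Proof.
by move=> Gn A2; rewrite -(odd_sqr_root Gn) groupX.
Qed.

Lemma Iirr_eq0_sqr i : {in A, forall x, 'chi[A]_i x ^+ 2 = 1} -> i = 0.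
Proof.
move=> chi2; have linA := char_abelianP _ abA i.
apply: irr_inj; rewrite irr0; apply/cfun_inP=> x Ax; rewrite cfun1E Ax.
rewrite -(odd_sqr_root (subsetP sAG x Ax)) lin_charX ?groupX // lin_charX //.
by rewrite chi2 // expr1n.
Qed.

(** For n outside A the map a -> a^-1 a^n is injective on A, because a nontrivial element fixed by n
    has centralizer A. Hence it is onto A, and a character fixed by n is trivial on its image. *)
Lemma conjg_Iirr_fix (i : Iirr A) n : i != 0 -> n \in N -> conjg_Iirr i n = i -> n \in A.
Proof.
move=> i0 Nn fix_n; apply: contraR i0 => A'n; apply/eqP/Iirr_eq0_sqr => y Ay.
have linA := char_abelianP _ abA i.
have Gn := subsetP sNG n Nn.
have In : n \in 'I['chi_i].
  by apply/setIdP; split; [exact: nAN | rewrite -conjg_IirrE fix_n].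
pose f a := (a^-1 * a ^ n)%g.
have fA a : a \in A -> f a \in A.
  by move=> Aa; rewrite groupM ?groupV ?memJ_norm ?nAN.
have fi : {in A &, injective f}.
  move=> a b Aa Ab fab; apply: contraNeq A'n => ab.
  have Ac : (b * a^-1)%g \in A^#.
    rewrite !inE groupM ?groupV // andbT; apply: contra ab.
    by rewrite -eq_mulgV1 eq_sym.
  rewrite -(centA Ac) inE Gn cent1C; apply/cent1P/commgP/conjg_fixP.
  rewrite conjMg conjVg; apply: (canLR (mulgK _)).
  have -> : (b ^ n = b * (a^-1 * a ^ n))%g by rewrite [(a^-1 * _)%g]fab mulKVg.
  by rewrite mulgA.
have fAA : f @: A = A.
  apply/eqP; rewrite eqEcard card_in_imset // leqnn andbT.
  by apply/subsetP=> _ /imsetP[a Aa ->]; exact: fA.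
have : y \in f @: A by rewrite fAA.
move=> /imsetP[a Aa ->].
rewrite /f lin_charM ?groupV ?memJ_norm ?nAN // lin_charV //.
by rewrite (inertia_valJ _ In) mulVf ?expr1n // lin_char_neq0.
Qed.

(** Otherwise n^2 fixes chi_i, so n^2 and then n lie in A; chi_i would be real, hence of trivial
    square. *)
Lemma conjg_Iirr_neq_conjC (i : Iirr A) n : i != 0 -> n \in N ->
  conjg_Iirr i n != conjC_Iirr i.
Proof.
move=> i0 Nn; apply/eqP => in_c.
have An : n \in A.
  apply: sqr_mem_odd; first exact: subsetP Nn.
  apply: (conjg_Iirr_fix i0); first exact: groupX.
  apply: irr_inj; rewrite conjg_IirrE expgS expg1 (cfConjgM _ nsAN) //.
  rewrite -conjg_IirrE in_c conjC_IirrE -conj_cfConjg -conjg_IirrE in_c.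
  by rewrite conjC_IirrE cfConjCK.
case/eqP: i0; apply: Iirr_eq0_sqr => x Ax.
have linA := char_abelianP _ abA i.
have /cfunP/(_ x) := congr1 (fun j => 'chi_j) in_c.
rewrite conjg_IirrE cfConjg_id // conjC_IirrE cfunE => chi_r.
by rewrite expr2 {2}chi_r -normCK normC_lin_char // expr1n.
Qed.

Lemma cfnorm_Dpsi i : i != 0 -> '[Dpsi i] = 2.
Proof.
move=> i0; rewrite cfdot_Dpsi.
rewrite (eq_bigr (fun n => if n \in A then 2 else 0)) => [|n Nn].
  rewrite -big_mkcondr /= (eq_bigl (mem A)) => [|n]; last first.
    by apply: andb_idl; apply: subsetP; exact: normal_sub nsAN.
  by rewrite sumr_const -[2 *+ _]mulr_natl mulKf // neq0CG.
rewrite [conjC_Iirr i == _]eq_sym (negPf (conjg_Iirr_neq_conjC _ _)) // subr0.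
case: ifPn => [An|A'n]; last first.
  rewrite (_ : _ == _ = false) ?mulr0 //; apply: contraNF A'n => /eqP/esym.
  exact: conjg_Iirr_fix.
rewrite (_ : conjg_Iirr i n = i) ?eqxx ?mulr1 //.
by apply: irr_inj; rewrite conjg_IirrE cfConjg_id.
Qed.

Lemma Dpsi1 i : Dpsi i 1%g = 0.
Proof. by rewrite cfInd1 // dpsi1 mulr0. Qed.

(** A virtual character of norm 2 vanishing at 1 is some chi_k - chi_l. Conjugation changes its
    sign, and the inner product with chi_k then forces l to be the conjugate of k. *)
Lemma DpsiP i : i != 0 ->
  exists2 k, Dpsi i = 'chi[G]_k - 'chi_(conjC_Iirr k) & conjC_Iirr k != k.
Proof.
move=> i0; have Zpsi : Dpsi i \in 'Z[irr G, G^#].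
  rewrite zcharD1E Dpsi1 eqxx andbT cfInd_vchar // rpredB ?irr_vchar //.
  by rewrite -conjC_IirrE irr_vchar.
have [k [l nlk dpsi_kl]] := vchar_norm2 Zpsi (cfnorm_Dpsi i0).
have conjD : 'chi_k - 'chi_l = 'chi_(conjC_Iirr l) - 'chi_(conjC_Iirr k).
  rewrite -dpsi_kl -[LHS]opprK -Dpsi_conjC /Dpsi dpsi_conjC.
  have -> : - dpsi i = (dpsi i)^*%CF by rewrite /dpsi rmorphB /= cfConjCK opprB.
  by rewrite -conj_cfInd -/(Dpsi i) dpsi_kl rmorphB /= !conjC_IirrE opprB.
have /(congr1 (cfdot^~ 'chi_k)) := conjD.
rewrite !cfdotBl !cfdot_irr eqxx (negPf nlk) subr0.
have [lk|_] := eqVneq (conjC_Iirr l) k.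
  have kl : conjC_Iirr k = l by rewrite -lk conjC_IirrK.
  by move=> _; exists k; rewrite kl.
case: (_ == _) => /eqP; rewrite ?subrr ?subr0 ?sub0r ?oner_eq0 //.
by rewrite -subr_eq0 opprK paddr_eq0 ?ler01 // oner_eq0.
Qed.

(** * Multiplicities of irreducible characters on A *)

Definition resmult (k : Iirr G) (j : Iirr A) : nat :=
  Num.truncn '['Res[A] 'chi_k, 'chi_j].

Lemma resmultE k j : (resmult k j)%:R = '['Res[A] 'chi_k, 'chi_j].
Proof. by rewrite truncnK // Cnat_cfdot_char ?cfRes_char ?irr_char. Qed.

Lemma resmult_conjC k j : resmult (conjC_Iirr k) j = resmult k (conjC_Iirr j).
Proof.
apply/eqP; rewrite -(eqr_nat algC) !resmultE conjC_IirrE -['chi_j]cfConjCK.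
by rewrite -conj_cfRes cfdot_conjC -conjC_IirrE -resmultE rmorph_nat.
Qed.

Lemma resmult_Dpsi k j : (resmult k j)%:R - (resmult k (conjC_Iirr j))%:R = '['chi_k, Dpsi j].
Proof. by rewrite !resmultE -cfdotBr conjC_IirrE cfdot_Res_l. Qed.

Lemma resmult0 j : resmult 0 j = (j == 0).
Proof.
by apply/eqP; rewrite -(eqr_nat algC) resmultE irr0 cfRes_cfun1 -irr0 cfdot_irr [0 == j]eq_sym.
Qed.

Lemma Dpsi_neq_conjC i k : i != 0 -> Dpsi i = 'chi_k - 'chi_(conjC_Iirr k) ->
  k != conjC_Iirr k.
Proof.
move=> i0 Di; apply: contraTneq isT => kc.
have /eqP := cfnorm_Dpsi i0.
by rewrite Di -kc subrr cfdot0l eq_sym pnatr_eq0.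
Qed.

(** The set I_A of characters attached to A: by [nonreal_onP], those k for which chi_k - chi_k^* is
    some [Dpsi i] with i nonprincipal. *)
Definition nonreal_on k := [exists j, resmult k j != resmult k (conjC_Iirr j)].
(** For abelian A this fails exactly when the restriction is a multiple of the regular character,
    that is, when chi_k vanishes on A^#. *)
Definition nonconst_on k := [exists j, resmult k j != resmult k 0].

Lemma nonreal_onP k :
  reflect (exists2 i, i != 0 & Dpsi i = 'chi_k - 'chi_(conjC_Iirr k)) (nonreal_on k).
Proof.
apply: (iffP existsP) => [[j]|[i i0 Di]].
  rewrite -(eqr_nat algC) -subr_eq0 resmult_Dpsi => dot0.
  have j0 : j != 0.
    apply: contraNneq dot0 => ->; rewrite /Dpsi /dpsi irr0 rmorph1 subrr.
    by rewrite raddf0 cfdot0r.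
  have [l Dj lc] := DpsiP j0.
  move: dot0; rewrite Dj cfdotBr !cfdot_irr.
  have [->|_] := eqVneq k l; first by exists j.
  have [->|_] := eqVneq k (conjC_Iirr l); last by rewrite subrr eqxx.
  move=> _; exists (conjC_Iirr j); first by rewrite conjC_Iirr_eq0.
  by rewrite Dpsi_conjC Dj opprB conjC_IirrK.
exists i; rewrite -(eqr_nat algC) -subr_eq0 resmult_Dpsi Di cfdotBr !cfdot_irr.
by rewrite eqxx (negPf (Dpsi_neq_conjC i0 Di)) subr0 oner_eq0.
Qed.

(* The sum over A^# of |chi_k|^2; spreadE expresses it through the squared
   differences of the multiplicities of chi_k on A. *)
Definition spread k : algC := \sum_(g in A^#) `|'chi[G]_k g| ^+ 2.

Let m k j : int := (resmult k j)%:Z.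

(** As A is abelian, chi_k(1) is the sum of the multiplicities and the norm on A is the sum of their
    squares; removing g = 1 subtracts chi_k(1)^2. *)
Lemma spreadE k : spread k =
  (#|Iirr A|%:R * (\sum_j m k j ^+ 2) - (\sum_j m k j) ^+ 2)%:~R.
Proof.
have cA : #|Iirr A| = #|A| by apply: card_Iirr_abelian.
have d1 : 'chi_k 1%g = (\sum_j m k j)%:~R.
  rewrite -(cfRes1 A) ['Res[A] _]cfun_sum_cfdot sum_cfunE rmorph_sum.
  apply: eq_bigr => j _; rewrite cfunE lin_char1 ?mulr1; last exact/char_abelianP.
  by rewrite /= -resmultE.
have d2 : #|A|%:R^-1 * (\sum_(g in A) `|'chi_k g| ^+ 2) = (\sum_j m k j ^+ 2)%:~R.
  transitivity '['Res[A] 'chi_k].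
    rewrite (cfnormE (cfun_onG _)); congr (_ * _).
    by apply: eq_bigr => x Ax; rewrite cfResE.
  rewrite cfdot_sum_irr rmorph_sum; apply: eq_bigr => j _.
  by rewrite -resmultE conj_natr ?rpred_nat // rmorphXn expr2.
rewrite rmorphB rmorphM rmorphXn rmorph_nat /= -d1 -d2 cA mulVKf ?neq0CG //.
rewrite [in RHS](big_setD1 1%g) //= addrC /spread.
have := irr1_gt0 k; rewrite lt0r => /andP[_ /ger0_norm ->].
by rewrite addrK.
Qed.

Lemma spread_ge0 k : 0 <= spread k.
Proof. by apply: sumr_ge0 => g _; rewrite exprn_ge0 ?normr_ge0. Qed.

Lemma spread_nonconst_on k : nonconst_on k -> #|A|%:R - 1 <= spread k.
Proof.
case/existsP=> j njk; rewrite spreadE -(card_Iirr_abelian abA).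
have := @spread_nonconst _ (m k) j 0; rewrite -(ler_int algC) rmorphB rmorph_nat.
by apply; rewrite /m eqz_nat.
Qed.

Lemma resmult_conjg k j n : n \in N -> resmult k (conjg_Iirr j n) = resmult k j.
Proof.
move=> Nn; apply/eqP; rewrite -(eqr_nat algC) !resmultE conjg_IirrE.
by rewrite cfdot_Res_conjg // (subsetP sNG).
Qed.

Lemma card_cfclass_free (i : Iirr A) : i != 0 -> #|cfclass_Iirr N i| = #|N : A|.
Proof.
move=> i0; rewrite card_cfclass_Iirr //; suff -> : 'I_N['chi_i]%g = A by [].
apply/eqP; rewrite eqEsubset (sub_Inertia _ (normal_sub nsAN)) andbT.
apply/subsetP=> n /setIP[Nn /setIdP[_ /eqP fix_n]].
by apply: (conjg_Iirr_fix i0) => //; apply: irr_inj; rewrite conjg_IirrE.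
Qed.

Lemma cfclass_conjC_disjoint (i : Iirr A) : i != 0 ->
  [disjoint cfclass_Iirr N i & cfclass_Iirr N (conjC_Iirr i)].
Proof.
move=> i0; rewrite -setI_eq0; apply/eqP/setP=> j; rewrite in_set0.
apply/negP=> /setIP[/imsetP[n Nn ->] /imsetP[n' Nn' nn']].
have /eqP[] := @conjg_Iirr_neq_conjC i (n * n'^-1)%g i0 (groupM Nn (groupVr Nn')).
apply: irr_inj; rewrite conjg_IirrE (cfConjgM _ nsAN) ?groupV //.
by rewrite -conjg_IirrE nn' conjg_IirrE cfConjgK.
Qed.

(* The multiplicities of chi_k on A are N-invariant and drop by exactly one from the
   orbit of lambda to the orbit of lambda^*, which bounds their spread below. *)
Lemma spread_nonreal k : nonreal_on k ->
  #|N : A|%:R * (#|A|%:R - #|N : A|%:R) <= spread k.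
Proof.
case/nonreal_onP=> i i0 Di; rewrite spreadE -(card_Iirr_abelian abA).
have mi : m k i = m k (conjC_Iirr i) + 1.
  apply/eqP; rewrite -(eqr_int algC) rmorphD /= -subr_eq0 opprD addrA.
  rewrite /m /= resmult_Dpsi Di cfdotBr !cfdot_irr eqxx.
  by rewrite (negPf (Dpsi_neq_conjC i0 Di)) subr0 subrr.
have ic0 : conjC_Iirr i != 0 by rewrite conjC_Iirr_eq0.
have := @spread_pair _ (m k) (cfclass_Iirr N i) (cfclass_Iirr N (conjC_Iirr i))
  (m k (conjC_Iirr i)) #|N : A|.
rewrite -(ler_int algC) rmorphM rmorphB !rmorph_nat; apply.
- exact: cfclass_conjC_disjoint.
- exact: card_cfclass_free.
- exact: card_cfclass_free.
- by move=> _ /imsetP[n Nn ->]; rewrite /m resmult_conjg.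
by move=> _ /imsetP[n Nn ->]; rewrite /m resmult_conjg.
Qed.

(** The inner product is 2, so by [cfdot_Dpsi] some n sends j to i or to i^*; the latter would give
    Dpsi i = - Dpsi i. *)
Lemma Dpsi_inj i j : i != 0 -> Dpsi i = Dpsi j -> i \in cfclass_Iirr N j.
Proof.
move=> i0 Dij; apply: contraT => nij.
have := cfnorm_Dpsi i0; rewrite {2}Dij cfdot_Dpsi => /eqP.
rewrite big1_seq ?mulr0 1?eq_sym ?pnatr_eq0 // => n /andP[Nn _].
have [ijn|_] := eqVneq i _; first by case/imsetP: nij; exists n.
have [ijn|_] := eqVneq (conjC_Iirr i) _; last by rewrite subrr mulr0.
have /eqP := cfnorm_Dpsi i0; rewrite {2}Dij -(DpsiJ j Nn) -ijn Dpsi_conjC.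
rewrite cfdotNr cfnorm_Dpsi // -subr_eq0 -opprD oppr_eq0 -natrD.
by rewrite pnatr_eq0.
Qed.

(** [DpsiP] gives each nonprincipal character of A some k; those with a given k lie in one N-orbit
    by [Dpsi_inj], of length |N : A|. *)
Lemma card_nonreal : (#|A|.-1 <= #|nonreal_on| * #|N : A|)%N.
Proof.
pose O k := [set i : Iirr A | (i != 0) && (Dpsi i == 'chi_k - 'chi_(conjC_Iirr k))].
have cO k : (#|O k| <= #|N : A|)%N.
  have [-> | [i]] := set_0Vmem (O k); first by rewrite cards0.
  rewrite inE => /andP[i0 /eqP Di]; rewrite -(card_cfclass_free i0).
  apply/subset_leq_card/subsetP=> j; rewrite inE => /andP[j0 /eqP Dj].
  by apply: Dpsi_inj; rewrite // Di.
have -> : #|A|.-1 = #|[set~ (0 : Iirr A)]|.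
  by rewrite cardsC1 card_Iirr_abelian.
apply: leq_trans (_ : #|\bigcup_(k in nonreal_on) O k| <= _)%N.
  apply/subset_leq_card/subsetP=> i; rewrite !inE => i0.
  have [k Dk _] := DpsiP i0; apply/bigcupP; exists k; last by rewrite inE i0 Dk /=.
  by apply/nonreal_onP; exists i.
rewrite -sum_nat_const; elim/big_rec2: _ => [|k x U _ leU]; first by rewrite cards0.
by rewrite (leq_trans (leq_card_setU _ _).1) // leq_add.
Qed.


Lemma exists_nonprincipal : exists i : Iirr A, i != 0.
Proof.
have /andP[/set0Pn[a /setD1P[a1 Aa]] _] := tiA.
have : (1 < #|Iirr A|)%N.
  rewrite card_Iirr_abelian // cardG_gt1; apply: contraNneq a1 => A1.
  by rewrite A1 in Aa; apply/eqP/set1P.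
rewrite (cardD1 0) ltnS => /card_gt0P[i]; rewrite !inE andbT => i0.
by exists i.
Qed.

Lemma exists_nonreal : exists k, nonreal_on k.
Proof.
have [i i0] := exists_nonprincipal; have [k Dk _] := DpsiP i0.
by exists k; apply/nonreal_onP; exists i.
Qed.

Lemma nonreal_on_neq0 k : nonreal_on k -> k != 0.
Proof.
case/nonreal_onP=> i i0 Di; apply: contraNneq (Dpsi_neq_conjC i0 Di) => ->.
by rewrite conjC_Iirr0.
Qed.

(** The orbits of i and of its conjugate are disjoint, of length |N : A|, and miss the principal
    character. *)
Lemma double_index_TI : (2 * #|N : A| < #|A|)%N.
Proof.
have [i i0] := exists_nonprincipal.
have ic0 : conjC_Iirr i != 0 by rewrite conjC_Iirr_eq0.
rewrite -(card_Iirr_abelian abA) mul2n -addnn.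
rewrite -{1}(card_cfclass_free i0) -(card_cfclass_free ic0).
rewrite -cardsUI (disjoint_setI0 (cfclass_conjC_disjoint i0)) cards0 addn0.
rewrite -[X in (_ < X)%N]cardsT; apply/proper_card/properP; split.
  exact: subsetT.
exists 0; rewrite ?inE // negb_or.
by apply/andP; split; apply/imsetP=> -[n _ /esym/eqP]; rewrite conjg_Iirr_eq0;
  apply/negP.
Qed.

(** Column orthogonality: each g in A^# contributes |C_G(g)| = |A|. *)
Lemma sum_spread : \sum_k spread k = (#|A|%:R - 1) * #|A|%:R.
Proof.
rewrite exchange_big /= (eq_bigr (fun _ => #|A|%:R)) => [|g A1g]; last first.
  have /setD1P[_ Ag] := A1g; rewrite -[in RHS](centA A1g).
  have := @second_orthogonality_relation _ G g g (subsetP sAG g Ag).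
  by rewrite class_refl mulr1n => <-; apply: eq_bigr => k _; rewrite normCK.
rewrite sumr_const -[_ *+ _]mulr_natl; congr (_ * _).
by rewrite [#|A|](cardsD1 1%g) group1 natrD addrC addKr.
Qed.

Lemma spread0 : spread 0 = #|A|%:R - 1.
Proof.
rewrite /spread (eq_bigr (fun _ => 1)) => [|g /setD1P[_ Ag]]; last first.
  by rewrite irr0 cfun1E (subsetP sAG) // normr1 expr1n.
by rewrite sumr_const [#|A|](cardsD1 1%g) group1 natrD addrC addKr.
Qed.

Definition real_nonconst : {set Iirr G} :=
  [set k | [&& k != 0, nonconst_on k & ~~ nonreal_on k]].

(** [sum_spread] is split over the principal character, [nonreal_on], [real_nonconst] and the rest,
    and each part is bounded below. *)
Lemma card_real_nonconst : (#|real_nonconst| < #|N : A|)%N.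
Proof.
set K := real_nonconst; have dw := double_index_TI.
have: spread 0 + \sum_(k in nonreal_on) spread k + \sum_(k in K) spread k
    <= \sum_k spread k.
  rewrite [X in _ <= X](bigD1 0) //= -addrA lerD2l [X in _ <= X](bigID nonreal_on) /=.
  apply: lerD.
    rewrite [X in _ <= X](eq_bigl nonreal_on) // => k; apply: andb_idl.
    exact: nonreal_on_neq0.
  rewrite [X in _ <= X](bigID nonconst_on) /= ler_wpDr //.
    by apply: sumr_ge0 => k _; exact: spread_ge0.
  rewrite le_eqVlt; apply/orP; left; apply/eqP/eq_bigl => k; rewrite /K inE.
  by case: (k != 0); case: (nonreal_on k); case: (nonconst_on k).
rewrite spread0 sum_spread.
have : #|nonreal_on|%:R * (#|N : A|%:R * (#|A|%:R - #|N : A|%:R))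
    <= \sum_(k in nonreal_on) spread k.
  rewrite mulr_natl -sumr_const; apply: ler_sum => k; exact: spread_nonreal.
have : #|K|%:R * (#|A|%:R - 1) <= \sum_(k in K) spread k.
  rewrite mulr_natl -sumr_const; apply: ler_sum => k; rewrite /K inE.
  by case/and3P=> _ nck _; exact: spread_nonconst_on.
move: (\sum_(k in K) _) (\sum_(k in nonreal_on) _) => S1 S2 leK leNR leS.
have := card_nonreal.
have: #|K|%:R * (#|A|%:R - 1)
     + #|nonreal_on|%:R * (#|N : A|%:R * (#|A|%:R - #|N : A|%:R)) + (#|A|%:R - 1)
   <= (#|A|%:R - 1) * #|A|%:R :> algC.
  apply: le_trans leS; rewrite [leLHS]addrC [X in _ + X <= _]addrC addrA.
  exact: lerD (lerD (lexx _) leNR) leK.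
have a1 : (0 < #|A|)%N := cardG_gt0 A.
have wa : (#|N : A| <= #|A|)%N by rewrite (leq_trans _ (ltnW dw)) // leq_pmull.
have -> : #|A|%:R - 1 = (#|A|.-1)%:R :> algC.
  by rewrite -{1}(prednK a1) -addn1 natrD addrK.
rewrite -natrB // -!natrM -!natrD ler_nat => le1 le2.
exact: nonconst_arith (indexg_gt0 _ _) dw le1 le2.
Qed.

End TIInduction.

Section OddPairing.
Local Open Scope ring_scope.

Lemma sum_involution_double (T : finType) (V : zmodType) (P : pred T)
    (s : T -> T) (F : T -> V) : involutive s ->
  (forall x, P x -> P (s x) && (s x != x)) -> (forall x, P x -> F (s x) = F x) ->
  exists2 Q : pred T, subpred Q P & \sum_(x | P x) F x = (\sum_(x | Q x) F x) *+ 2.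
Proof.
move=> sK sP sF.
have Ps x : P (s x) = P x.
  by apply/idP/idP=> [/sP|/sP]; rewrite ?sK => /andP[].
pose lt (x y : T) := (enum_rank x < enum_rank y)%N.
exists (fun x => P x && lt x (s x)); first by move=> x /andP[].
rewrite mulr2n (bigID (fun x => lt x (s x))) /=; congr (_ + _).
rewrite (reindex_inj (can_inj sK)) /=.
apply: eq_big => [x|x /andP[Px _]]; last by rewrite sF // -Ps.
rewrite Ps sK /lt -leqNgt leq_eqVlt; case Px: (P x) => //=.
have /sP/andP[_ sx] := Px.
by rewrite (inj_eq val_inj) (inj_eq enum_rank_inj) eq_sym (negPf sx).
Qed.

(* If chi is real, summing chi over G in pairs {x, x^-1} gives chi(1) = -2 alpha with
   alpha an algebraic integer, so the odd number |G| would be divisible by 2. *)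
Lemma odd_irr_nonreal (gT : finGroupType) (G : {group gT}) (k : Iirr G) :
  odd #|G| -> k != 0 -> conjC_Iirr k != k.
Proof.
move=> oddG k0; apply: contraTneq oddG => kc.
have sum0 : \sum_(x in G) 'chi_k x = 0.
  have /eqP := cfdot_irr k 0; rewrite (negPf k0) irr0 cfdotE mulf_eq0.
  rewrite invr_eq0 (negPf (neq0CG G)) /= => /eqP s0; rewrite -[RHS]s0.
  by apply: eq_bigr => x Gx; rewrite cfun1E Gx rmorph1 mulr1.
have [oddG|//] := boolP (odd #|G|).
have [Q QG sumQ] : exists2 Q : pred gT, subpred Q [pred x in G^#] &
    \sum_(x in G^#) 'chi_k x = (\sum_(x | Q x) 'chi_k x) *+ 2.
  apply: (@sum_involution_double _ _ _ invg) => [x|x|x _]; first exact: invgK.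
    move=> /setD1P[x1 Gx]; rewrite !inE groupV Gx invg_eq1 x1 /=.
    apply: contra x1 => /eqP xV; rewrite -order_eq1 -dvdn1.
    have ox : (#[x] %| 2)%N by rewrite order_dvdn expgS expg1 -{1}xV mulVg.
    have : coprime #|G| 2 by rewrite coprimen2.
    by rewrite /coprime => /eqP <-; rewrite dvdn_gcd ox order_dvdG.
  by rewrite irr_inv -{2}kc conjC_IirrE cfunE.
have : 'chi_k 1%g = - (\sum_(x | Q x) 'chi_k x) *+ 2.
  by apply/eqP; rewrite mulNrn -addr_eq0 -sumQ -(big_setD1 1%g) ?sum0.
set al := \sum_(x | _) _ => d2.
have [n dn] := natrP (Cnat_irr1 k).
have al_int : al \in Num.int.
  rewrite Cint_rat_Aint //; last by apply: rpred_sum => x _; exact: Aint_irr.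
  have -> : al = - 'chi_k 1%g / 2.
    by apply: (canRL (mulfK _)); rewrite ?pnatr_eq0 // d2 mulNrn opprK mulr_natr.
  by rewrite rpred_div ?rpredN ?dn ?rpred_nat.
have [z dz] := intrP al_int.
have n2 : (2 %| n)%N.
  have : n%:Z = - z *+ 2.
    by apply/eqP; rewrite -(eqr_int algC) rmorphMn rmorphN /= -dz -d2 dn.
  lia.
have := dvd_irr1_cardG k; rewrite dn.
rewrite dvdC_nat => dG; have := dvdn_trans n2 dG.
by rewrite dvdn2 oddG.
Qed.

End OddPairing.

(** * Two TI subgroups whose nontrivial elements are never conjugate *)

Section TwoTI.

Variables (gT : finGroupType) (G A B : {group gT}).
Hypothesis oddG : odd #|G|.
Hypothesis (caA : CA_subgroup G A) (caB : CA_subgroup G B).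
Hypothesis dAB : [disjoint class_support A^# G & class_support B^# G].

Local Open Scope ring_scope.

Lemma CA_sub_sub (D : {group gT}) : CA_subgroup G D -> D \subset G.
Proof.
case=> _ /andP[/set0Pn[a Da] _] cD.
by rewrite -(cD a Da) subsetIl.
Qed.

Lemma cfdot_Ind_disjoint (phi : 'CF(A)) (psi : 'CF(B)) :
  phi 1%g = 0 -> psi 1%g = 0 -> '['Ind[G] phi, 'Ind[G] psi] = 0.
Proof.
have cf1 (D : {group gT}) (al : 'CF(D)) : al 1%g = 0 -> al \in 'CF(D, D^#).
  by move=> al1; rewrite cfun_onD1 al1 cfun_onG eqxx.
move=> /cf1 phi1 /cf1 psi1.
rewrite (cfdotElr (cfInd_on (CA_sub_sub caA) phi1) (cfInd_on (CA_sub_sub caB) psi1)).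
by rewrite (disjoint_setI0 dAB) big_set0 mulr0.
Qed.

(** A common k would equate a [Dpsi] of A with one of B: norm 2, yet disjoint supports. *)
Lemma nonreal_on_disjoint (k : Iirr G) : nonreal_on A k -> ~~ nonreal_on B k.
Proof.
case/(nonreal_onP oddG caA)=> i i0 Di; apply/(nonreal_onP oddG caB)=> -[j j0 Dj].
have := cfnorm_Dpsi oddG caA i0; rewrite {2}Di -Dj.
rewrite cfdot_Ind_disjoint ?(dpsi1 caA) ?(dpsi1 caB) //.
by move/eqP; rewrite eq_sym pnatr_eq0.
Qed.

(* The products (m_0 - m_i)(m'_0 - m'_j) of multiplicities on A and B sum to 0 over
   Irr G, since Ind(1 - lambda_i) and Ind(1 - lambda_j) have disjoint supports.  If both
   conclusions fail, the summand is invariant under complex conjugation, so the sum has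
   the parity of its principal term, which is 1. *)
Lemma nonconst_on_dichotomy (k1 k2 : Iirr G) : nonreal_on A k1 -> ~~ nonconst_on B k1 ->
  nonreal_on B k2 -> nonconst_on A k2.
Proof.
move=> /(nonreal_onP oddG caA)[i i0 Di] constB /(nonreal_onP oddG caB)[j j0 Dj].
apply: contraT => constA.
pose f (k : Iirr G) : int := (resmult k (0 : Iirr A))%:Z - (resmult k i)%:Z.
pose f' (k : Iirr G) : int := (resmult k (0 : Iirr B))%:Z - (resmult k j)%:Z.
pose c := @conjC_Iirr _ G.
have sum0 : \sum_k f k * f' k = 0.
  apply: (@intr_inj algC); rewrite rmorph0 rmorph_sum /=.
  rewrite -[RHS](@cfdot_Ind_disjoint (1 - 'chi_i) (1 - 'chi_j)); first last.
  - by rewrite !cfunE cfun11 lin_char1 ?subrr //; apply/char_abelianP; case: caB.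
  - by rewrite !cfunE cfun11 lin_char1 ?subrr //; apply/char_abelianP; case: caA.
  have dotE (D : {group gT}) (l : Iirr D) k :
      '['Ind[G] (1 - 'chi_l), 'chi_k] = (resmult k (0 : Iirr D))%:R - (resmult k l)%:R.
    rewrite -Frobenius_reciprocity cfdotC cfdotBr -irr0 -!resmultE.
    by rewrite rmorphB /= !conjC_nat.
  rewrite cfdot_sum_irr; apply: eq_bigr => k _.
  by rewrite !dotE rmorphM !rmorphB /= !conjC_nat.
have fc k : f (c k) = f k \/ k = k1 \/ k = c k1.
  have [->|n1] := eqVneq k k1; first by auto.
  have [->|n2] := eqVneq k (c k1); first by auto.
  left; rewrite /f !resmult_conjC // conjC_Iirr0; congr (_ - Posz _).
  apply/eqP; rewrite eq_sym -(eqr_nat algC) -subr_eq0 resmult_Dpsi // Di.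
  by rewrite cfdotBr !cfdot_irr (negPf n1) (negPf n2) subrr.
have f'c k : f' (c k) = f' k \/ k = k2 \/ k = c k2.
  have [->|n1] := eqVneq k k2; first by auto.
  have [->|n2] := eqVneq k (c k2); first by auto.
  left; rewrite /f' !resmult_conjC // conjC_Iirr0; congr (_ - Posz _).
  apply/eqP; rewrite eq_sym -(eqr_nat algC) -subr_eq0 resmult_Dpsi // Dj.
  by rewrite cfdotBr !cfdot_irr (negPf n1) (negPf n2) subrr.
(* [f] can fail to be invariant under conjugation only at k1 and its conjugate, where constancy on B
   annihilates [f']; symmetrically for k2. *)
have f'0 : f' k1 = 0.
  move: constB; rewrite negb_exists => /forallP/(_ j); rewrite negbK => /eqP e.
  by rewrite /f' e subrr.
have f'c0 : f' (c k1) = 0.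
  move: constB; rewrite negb_exists => /forallP/(_ (conjC_Iirr j)).
  by rewrite negbK => /eqP e; rewrite /f' !resmult_conjC // e conjC_Iirr0 subrr.
have f0 : f k2 = 0.
  move: constA; rewrite negb_exists => /forallP/(_ i); rewrite negbK => /eqP e.
  by rewrite /f e subrr.
have fc0 : f (c k2) = 0.
  move: constA; rewrite negb_exists => /forallP/(_ (conjC_Iirr i)).
  by rewrite negbK => /eqP e; rewrite /f !resmult_conjC // e conjC_Iirr0 subrr.
have ccK : involutive c := @conjC_IirrK _ G.
have ffc k : f (c k) * f' (c k) = f k * f' k.
  have [->|[->|->]] := fc k; last by rewrite ccK f'0 f'c0 !mulr0.
    have [->|[->|->]] := f'c k; rewrite ?ccK ?f0 ?fc0 ?mul0r //.
  by rewrite f'0 f'c0 !mulr0.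
have [Q _ sumQ] : exists2 Q : pred (Iirr G), subpred Q (fun k => k != 0) &
   \sum_(k | k != 0) f k * f' k = (\sum_(k | Q k) f k * f' k) *+ 2.
  apply: (sum_involution_double ccK) => k k0; last exact: ffc.
  by rewrite conjC_Iirr_eq0 k0 odd_irr_nonreal.
move: sum0; rewrite (bigD1 0) //= sumQ /f /f' !resmult0 // !eqxx (negPf i0) (negPf j0).
lia.
Qed.

End TwoTI.

(** * Groups in which centralisers are abelian, odd order *)

Definition CA_group (gT : finGroupType) (G : {set gT}) :=
  {in G^#, forall x, abelian 'C_G[x]}.

Section CAGroups.

Variables (gT : finGroupType) (G : {group gT}).
Hypothesis caG : CA_group G.

(** Both centralizers are abelian and contain x and y. *)
Lemma cent1_CA x y : x \in G^# -> y \in 'C_G[x]^# -> 'C_G[y] = 'C_G[x].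
Proof.
move=> G1x /setD1P[y1 Cy]; have /setIP[Gy cxy] := Cy.
have G1y : y \in G^# by rewrite !inE y1.
have [x1 Gx] := setD1P G1x.
have Cx : x \in 'C_G[y] by rewrite inE Gx cent1C.
apply/eqP; rewrite eqEsubset !subsetI !subsetIl /= !sub_cent1.
by rewrite (subsetP (caG G1y)) // (subsetP (caG G1x)).
Qed.

Lemma normedTI_cent1 x : x \in G^# -> normedTI 'C_G[x]^# G 'N_G('C_G[x]).
Proof.
move=> G1x; have [x1 Gx] := setD1P G1x; apply/normedTI_memJ_P; split.
- by apply/set0Pn; exists x; rewrite in_setD1 x1 inE Gx cent1id.
- exact: subsetIl.
move=> a g Ca Gg; rewrite in_setI Gg /=; apply/idP/idP=> [Cag | nCg].
  apply/normP; rewrite -{1}(cent1_CA G1x Ca) conjIg conjGid // -cent1J.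
  exact: cent1_CA.
by rewrite memJ_norm // normD1.
Qed.

Lemma CA_subgroup_cent1 x : x \in G^# -> CA_subgroup G 'C_G[x].
Proof.
by move=> G1x; split=> [||a]; [exact: caG | exact: normedTI_cent1 | exact: cent1_CA].
Qed.

Lemma class_support_cent1P x y : x \in G^# -> y \in G^# ->
  reflect (exists2 g, g \in G & 'C_G[y] = 'C_G[x] :^ g)
          (y \in class_support 'C_G[x]^# G).
Proof.
move=> G1x G1y; have [y1 Gy] := setD1P G1y.
apply: (iffP imset2P) => [[a g Ca Gg ->]|[g Gg defC]].
  by exists g => //; rewrite cent1J -{1}(conjGid Gg) -conjIg (cent1_CA G1x Ca).
exists (y ^ g^-1) g; rewrite ?conjgKV // in_setD1 conjg_eq1 y1 /=.
by rewrite -mem_conjg -defC inE Gy cent1id.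
Qed.

End CAGroups.

(** The last two bounds give T <= n w^2 - D^2 and U <= (w - 1) n w. Inserted in the equation for |G|
    = n w a, they leave D^2 - 1 <= - n (w - 1) (a - 1 - 2 w), which is impossible. *)
Lemma odd_CA_arith n w a T U D : 0 < n -> 0 < w -> (2 * w < a)%N -> 1 < D ->
  (n * (w * a) = 1 + a.-1 * n + T + U)%N ->
  (D * D + n * (w * (a - w)) + T <= n * (w * a))%N ->
  (U * a <= w.-1 * (n * (w * a)))%N -> False.
Proof.
move=> n0 w0 dw D1 def_g leT leU; have a0 : 0 < a by lia.
have {}leU : U <= w.-1 * (n * w) by rewrite -(leq_pmul2r a0) -!mulnA.
have split_a : (n * (w * a) = n * (w * (a - w)) + n * (w * w))%N.
  by rewrite -!mulnDr subnK //; lia.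
have D2 : (4 <= D * D)%N by rewrite (@leq_mul 2 2).
have : n * (a.-1 + w * w + w.-1 * w) <= n * (w * a).
  rewrite leq_pmul2l // -[in leqRHS](prednK a0) -(prednK w0).
  have : (2 * w.-1.+1 <= a.-1)%N by lia.
  move: (w.-1) (a.-1) => u b leb; have : u * (2 * u.+1) <= u * b by rewrite leq_mul2l leb orbT.
  lia.
rewrite !mulnDr; move: split_a def_g leT leU D2.
have -> : (w.-1 * (n * w) = n * (w.-1 * w))%N by lia.
rewrite [(a.-1 * n)%N]mulnC.
move: (n * (w * a))%N (n * (w * (a - w)))%N (n * (w * w))%N (n * a.-1)%N.
move: (D * D)%N (n * (w.-1 * w))%N => *; lia.
Qed.

Lemma sum_class_support (gT : finGroupType) (G A : {group gT}) (V : zmodType)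
    (F : gT -> V) : normedTI A^# G 'N_G(A) ->
  {in A^# & G, forall x g, F (x ^ g) = F x} ->
  (\sum_(y in class_support A^# G) F y = (\sum_(y in A^#) F y) *+ #|G : 'N_G(A)|)%R.
Proof.
move=> tiA FJ; have partA := partition_normedTI tiA.
rewrite (set_partition_big _ partA) /= (eq_bigr (fun _ => \sum_(y in A^#) F y)%R).
  by rewrite sumr_const card_conjugates normD1.
move=> _ /imsetP[g Gg ->]; rewrite big_imset /=; last exact: in2W (conjg_inj g).
by apply: eq_bigr => x Ax; exact: FJ.
Qed.

(** * Perfect groups of odd order with abelian centralizers *)

Section OddCA.

Variables (gT : finGroupType) (G : {group gT}).
Hypothesis oddG : odd #|G|.
Hypothesis caG : CA_group G.
Hypothesis perfG : G^`(1) = G.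

Let C y := 'C_G[y]%G.

Lemma group_index_cardM x : x \in G^# ->
  (#|G : 'N_G(C x)| * (#|'N_G(C x) : C x| * #|C x|) = #|G|)%N.
Proof.
move=> G1x; rewrite [(_ * #|C x|)%N]mulnC.
by rewrite Lagrange ?subsetI ?subsetIl ?normG // mulnC Lagrange ?subsetIl.
Qed.

Lemma fiber_cent1 (S : {set gT}) y : y \in S -> S \subset G^# ->
    {in G^#, forall z, 'C_G[z] = 'C_G[y] -> z \in S} ->
  [set z in S | C z == C y] = (C y)^#.
Proof.
move=> Sy sSG Scl; have G1y := subsetP sSG y Sy.
apply/setP=> z; rewrite inE; apply/andP/idP=> [[Sz /eqP Czy]|Cz].
  have /setD1P[z1 Gz] := subsetP sSG z Sz.
  by rewrite -Czy in_setD1 z1 inE Gz cent1id.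
have Czy := cent1_CA caG G1y Cz; split; last by apply/eqP/val_inj.
by apply: Scl => //; apply: subsetP Cz; rewrite setSD ?subsetIl.
Qed.

(** The last condition makes S a disjoint union of punctured centralizers; [spread_nonconst_on]
    applies to each. *)
Lemma card_nonconst_le (k : Iirr G) (S : {set gT}) : S \subset G^# ->
    {in S, forall y, nonconst_on (C y) k} ->
    {in S, forall y, {in G^#, forall z, 'C_G[z] = 'C_G[y] -> z \in S}} ->
  (#|S|%:R <= \sum_(y in S) `|'chi_k y| ^+ 2 :> algC)%R.
Proof.
move=> sSG ncS clS; rewrite -sum1_card natr_sum.
rewrite (partition_big C xpredT) //= [leRHS](partition_big C xpredT) //=.
apply: ler_sum => B _.
have [/existsP[y /andP[Sy /eqP <-]]|noB] := boolP [exists y, (y \in S) && (C y == B)].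
  have G1y := subsetP sSG y Sy.
  have fib := fiber_cent1 Sy sSG (clS y Sy).
  have fibE z : (z \in S) && (C z == C y) = (z \in (C y)^#) by rewrite -fib inE.
  rewrite !(eq_bigl _ _ fibE) -natr_sum sum1_card.
  have := spread_nonconst_on (CA_subgroup_cent1 caG G1y) (ncS y Sy).
  by rewrite [#|C y|](cardsD1 1) group1 natrD addrC addKr.
rewrite !big1 // => y SyB; case/existsP: noB; exists y => //.
Qed.

Lemma nonreal_on_conj (k : Iirr G) x y : x \in G^# -> y \in G^# ->
  nonreal_on (C x) k -> nonreal_on (C y) k ->
  exists2 g, g \in G & 'C_G[y] = 'C_G[x] :^ g.
Proof.
move=> G1x G1y NRx NRy.
have : ~~ [disjoint class_support (C x)^# G & class_support (C y)^# G].
  apply: contraL NRy => dxy; apply: nonreal_on_disjoint NRx => //;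
  exact: CA_subgroup_cent1.
case/pred0Pn=> z /andP[/= zx zy].
have G1z : z \in G^#.
  case/imset2P: zx => b g /setD1P[b1 /setIP[Gb _]] Gg ->.
  by rewrite !inE conjg_eq1 b1 groupJ.
have [g Gg Cg] := class_support_cent1P caG G1x G1z zx.
have [h Gh Ch] := class_support_cent1P caG G1y G1z zy.
by exists (g * h^-1); rewrite ?groupM ?groupV // conjsgM -Cg Ch conjsgK.
Qed.

(* Counting elements y of S through the characters attached to their centralizers: all
   of them lie in real_nonconst, which has fewer than w members. *)
Lemma card_const_le x (S : {set gT}) (a := #|C x|) (w := #|'N_G(C x) : C x|) :
    x \in G^# -> {in G^#, forall y, a <= #|C y|} -> S \subset G^# ->
    {in S, forall y, {in G^#, forall z, 'C_G[z] = 'C_G[y] -> z \in S}} ->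
    {in S, forall y (k : Iirr G), nonreal_on (C y) k -> k \in real_nonconst G (C x)} ->
  (#|S| * a <= w.-1 * #|G|)%N.
Proof.
move=> G1x mina sSG clS NRS; pose CS := [set C y | y in S].
pose R := real_nonconst G (C x).
have cR : #|R| <= w.-1.
  by rewrite -ltnS prednK ?indexg_gt0 // card_real_nonconst //; exact: CA_subgroup_cent1.
apply: leq_trans (_ : #|R| * #|G| <= _)%N; last by rewrite leq_mul2r cR orbT.
pose wt (B : {group gT}) := #|'N_G(B) : B|.
apply: leq_trans (_ : (\sum_(k in R) \sum_(B in CS | nonreal_on B k) wt B) * a <= _)%N.
  rewrite leq_mul2r; apply/orP; right.
  rewrite -sum1_card (partition_big C (mem CS)) /=; last first.
    by move=> y Sy; exact: imset_f.
  rewrite (exchange_big_dep (mem CS)) /=; last by move=> k B _ /andP[].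
  apply: leq_sum => _ /imsetP[y Sy ->]; have G1y := subsetP sSG y Sy.
  have fib := fiber_cent1 Sy sSG (clS y Sy).
  have fibE z : (z \in S) && (C z == C y) = (z \in (C y)^#) by rewrite -fib inE.
  rewrite (eq_bigl _ _ fibE) sum1_card.
  have := card_nonreal oddG (CA_subgroup_cent1 caG G1y).
  rewrite [in X in X -> _](cardsD1 1) group1 add1n /= => /leq_trans-> //.
  rewrite sum_nat_const leq_mul2r; apply/orP; right.
  apply/subset_leq_card/subsetP=> k NRk; rewrite unfold_in /=.
  by rewrite (imset_f C Sy) (NRS y).
rewrite -sum_nat_const big_distrl /=; apply: leq_sum => k _.
pose CSk := [set B in CS | nonreal_on B k].
rewrite (eq_bigl (fun B => B \in CSk)) => [|B]; last by rewrite inE.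
have [-> | [B0]] := set_0Vmem CSk; first by rewrite big1 // => B; rewrite inE.
rewrite inE => /andP[/imsetP[y Sy ->] NRy]; have G1y := subsetP sSG y Sy.
(* For fixed k the centralizers with k attached are all conjugate, so at most |G : N(B)| in number;
   weight and minimality of [a] then bound their total by |G|. *)
have conjB (B : {group gT}) : B \in CSk -> exists2 g, g \in G & gval B = C y :^ g.
  rewrite inE => /andP[/imsetP[z Sz ->] NRz].
  exact: nonreal_on_conj G1y (subsetP sSG z Sz) NRy NRz.
rewrite (eq_bigr (fun _ => wt (C y))) => [|B /conjB[g Gg defB]]; last first.
  rewrite /wt defB -{1}(conjGid Gg) normJ -conjIg.
  by rewrite -!divgS ?conjSg ?subsetI ?subsetIl ?normG // !cardJg.
rewrite sum_nat_const -(group_index_cardM G1y) -mulnA leq_mul //; last first.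
  by rewrite leq_mul2l mina ?orbT.
rewrite -card_conjugates -(card_imset _ val_inj).
apply/subset_leq_card/subsetP=> _ /imsetP[B CB ->].
by have [g Gg defB] := conjB B CB; rewrite [val B]defB imset_f.
Qed.

(** Take A of least order among the centralizers and k attached to A. Apart from 1 and the
    conjugates [P] of A^#, the group splits into [T] and [U] according to whether the multiplicities
    of chi_k on the centralizer of the element vary. The norm of chi_k bounds [T], and
    [card_const_le] bounds [U]. *)
Lemma odd_CA_perfect : G :=: 1.
Proof.
apply/eqP/idPn=> /trivgPn[x0 Gx0 x01].
have G1x0 : x0 \in G^# by rewrite !inE x01.
pose x := [arg min_(y < x0 in G^#) #|'C_G[y]|].
have [G1x minx] : x \in G^# /\ forall y, y \in G^# -> #|'C_G[x]| <= #|'C_G[y]|.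
  by rewrite /x; case: arg_minnP.
pose A := C x; have caA : CA_subgroup G A := CA_subgroup_cent1 caG G1x.
have [k NRk] := exists_nonreal oddG caA.
have sAG : A \subset G := subsetIl _ _.
pose w := #|'N_G(A) : A|; pose a := #|A|; pose n := #|G : 'N_G(A)|.
have cardG : (n * (w * a) = #|G|)%N := group_index_cardM G1x.
pose P := class_support A^# G.
have cardP : #|P| = (a.-1 * n)%N.
  have /card_support_normedTI -> := normedTI_cent1 caG G1x.
  by rewrite /a [#|A|](cardsD1 1) group1.
pose T := [set y in G^# | (y \notin P) && nonconst_on (C y) k].
pose U := [set y in G^# | (y \notin P) && ~~ nonconst_on (C y) k].
have sPG : P \subset G^#.
  apply/subsetP=> _ /imset2P[b g /setD1P[b1 Ab] Gg ->].
  by rewrite !inE conjg_eq1 b1 groupJ // (subsetP sAG).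
have P_C y z : y \in G^# -> z \in G^# -> 'C_G[z] = 'C_G[y] -> (z \in P) = (y \in P).
  move=> G1y G1z eqC.
  by apply/(class_support_cent1P caG G1x G1z)/(class_support_cent1P caG G1x G1y);
    rewrite eqC.
have cardPTU : #|G| = (1 + #|P| + #|T| + #|U|)%N.
  rewrite [LHS](cardsD1 1) group1 -!addnA; congr (_ + _)%N.
  rewrite -[LHS](cardsID P); congr (_ + _)%N.
    by rewrite (setIidPr sPG).
  rewrite -[LHS](cardsID [set y | nonconst_on (C y) k]).
  by congr (_ + _)%N; apply: eq_card => y; rewrite !inE; case: (y \in P);
    case: nonconst_on; rewrite /= ?andbF ?andbT.
have w0 : 0 < w := indexg_gt0 _ _.
have dw : (2 * w < a)%N := double_index_TI oddG caA.
have [D chi1] := natrP (Cnat_irr1 k).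
have D1 : 1 < D.
  have : 0 < D by rewrite -(ltr_nat algC) -chi1 irr1_gt0.
  rewrite leq_eqVlt => /orP[/eqP D1|//].
  have lin_k : ('chi_k \is a linear_char)%R by rewrite qualifE /= irr_char chi1 -D1 eqxx.
  have := nonreal_on_neq0 oddG caA NRk; rewrite -irr_eq1.
  case/eqP; apply/cfun_inP=> y Gy; rewrite cfun1E Gy.
  have := lin_char_der1 lin_k; rewrite perfG => /subsetP/(_ y Gy) ker_y.
  by rewrite -(mulg1 y) (cfkerMl _ ker_y) chi1 -D1.
apply: (@odd_CA_arith n w a #|T| #|U| D) => //.
- exact: indexg_gt0.
- by rewrite cardG cardPTU cardP.
- rewrite cardG -(ler_nat algC) !natrD !natrM.
  have norm1 : (\sum_(y in G) `|'chi_k y| ^+ 2 = #|G|%:R :> algC)%R.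
    have := cfnorm_irr k; rewrite (cfnormE (cfun_onG _)) => /(congr1 ( *%R #|G|%:R)).
    by rewrite mulVKf ?neq0CG // mulr1.
  rewrite -norm1 (big_setD1 1) //= (big_setID P) (setIidPr sPG) /=.
  rewrite -addrA; apply: lerD; first by rewrite chi1 normr_nat expr2.
  apply: lerD.
    rewrite (sum_class_support (normedTI_cent1 caG G1x)) => [|y g _ Gg]; last first.
      by rewrite cfunJ.
    rewrite -[leRHS]mulr_natl ler_wpM2l ?ler0n // natrB; last by lia.
    exact: spread_nonreal.
  apply: le_trans (_ : (\sum_(y in T) `|'chi_k y| ^+ 2 <= _)%R).
    apply: card_nonconst_le => [|y|y].
    - by apply/subsetP=> y; rewrite inE => /andP[].
    - by rewrite inE => /and3P[].
    rewrite inE => /and3P[G1y Py ncy] z G1z eqC; rewrite inE G1z.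
    by rewrite (P_C y z) // Py /C (group_inj eqC).
  have sT : T \subset G^# :\: P.
    apply/subsetP=> y; rewrite inE => /and3P[G1y Py _].
    by rewrite in_setD G1y Py.
  rewrite [leRHS](big_setID T) /= (setIidPr sT) lerDl.
  by apply: sumr_ge0 => y _; rewrite exprn_ge0.
rewrite cardG; apply: card_const_le => //.
- by apply/subsetP=> y; rewrite inE => /andP[].
- move=> y; rewrite inE => /and3P[G1y Py ncy] z G1z eqC; rewrite inE G1z.
  by rewrite (P_C y z) // Py /C (group_inj eqC).
move=> y; rewrite inE => /and3P[G1y Py ncy] k' NRk'.
have caC := CA_subgroup_cent1 caG G1y.
have dAC : [disjoint class_support A^# G & class_support (C y)^# G].
  apply: contraR Py => /pred0Pn[z /andP[/= zA zC]].
  have G1z := subsetP sPG z zA.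
  have [g Gg Cg] := class_support_cent1P caG G1x G1z zA.
  have [h Gh Ch] := class_support_cent1P caG G1y G1z zC.
  apply/(class_support_cent1P caG G1x G1y).
  by exists (g * h^-1); rewrite ?groupM ?groupV // conjsgM -Cg Ch conjsgK.
rewrite inE (nonreal_on_neq0 oddG caC NRk') /=.
rewrite (nonconst_on_dichotomy oddG caA caC dAC NRk ncy NRk') /=.
by apply: contraL NRk' => NRA; apply: nonreal_on_disjoint NRA.
Qed.

End OddCA.

(** * Finite groups whose nonabelian subgroups are self-normalizing *)

(** By the fusion hypothesis the transfer of x to R / R' is the class of x^|G : R|. It is trivial
    because x lies in G', and |G : R| is prime to the order of x. *)
Lemma transfer_focal (gT : finGroupType) (G R : {group gT}) r x :
    r.-Sylow(G) R -> x \in R -> x \in G^`(1) ->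
    (forall n g, g \in G -> (x ^+ n) ^ g \in R ->
       coset R^`(1) ((x ^+ n) ^ g) = coset R^`(1) (x ^+ n)) ->
  x \in R^`(1).
Proof.
move=> sylR Rx G'x fus; have sRG := pHall_sub sylR.
have Gx := subsetP sRG x Rx.
have nR'R : R \subset 'N(R^`(1)) by rewrite der_norm.
pose alpha := [morphism of restrm nR'R (coset R^`(1))].
have abA : abelian (alpha @* R).
  by rewrite morphim_restrm setIid; exact: der_abelian.
have Rpow n : x ^+ n \in R by rewrite groupX.
have [X trX] : exists X, is_transversal X (rcosets R G :* <[x]>) G.
  exists (transversal (rcosets R G :* <[x]>) G).
  exact/transversalP/(rcosets_cycle_partition sRG Gx).
have V0 : transfer G abA x = 0%R.
  have /subsetP/(_ x G'x) : G^`(1) \subset 'ker (transfer_morphism G abA).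
    rewrite gen_subG; apply/subsetP=> _ /imset2P[a b Ga Gb ->].
    apply/kerP; first exact: groupR.
    rewrite morphR //; apply/eqP/commgP; exact: GRing.addrC.
  by move/mker.
move: (transfer_cycle_expansion sRG abA Gx trX); rewrite V0.
have fa n : coset R^`(1) (x ^+ n) \in alpha @* R.
  by rewrite (mem_morphim alpha) // Rpow.
rewrite (eq_bigr (fun y => fmod abA (coset R^`(1) x) *+ #|<[x]> : R :* y|)%R).
  rewrite sumrMnr (sum_index_rcosets_cycle sRG Gx trX) -fmodX; last exact: (fa 1%N).
  move/(congr1 val); rewrite fmval0 fmodK ?groupX ?(fa 1%N) // => /esym/eqP.
  rewrite -order_dvdn => dvd_x; apply: coset_idr; first exact: subsetP Rx.
  apply/eqP; rewrite -order_eq1 -dvdn1.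
  have co : coprime #[coset R^`(1) x] #|G : R|.
    apply: (@pnat_coprime r); last by case/and3P: sylR.
    by apply: morph_p_elt; [exact: subsetP Rx | exact: mem_p_elt (pHall_pgroup sylR) Rx].
  rewrite -(Gauss_dvdl 1 co) mul1n //.
move=> y Xy; have Gy := subsetP (transversal_sub trX) y Xy.
set m := #|_ : _|.
have Rxy : (x ^+ m) ^ y^-1 \in R.
  have := mulg_exp_card_rcosets R x y; rewrite mem_rcoset -/m => Rxm.
  by rewrite conjgE invgK mulgA.
rewrite -fmodX; last exact: (fa 1%N).
change (fmod abA (coset R^`(1) ((x ^+ m) ^ y^-1)) = fmod abA (coset R^`(1) x ^+ m)).
rewrite fus ?groupV //.
by rewrite morphX //; exact: subsetP Rx.
Qed.

Definition Yn (gT : finGroupType) (G : {group gT}) :=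
  forall H : {group gT}, H \subset G -> ~~ abelian H -> 'N_G(H) \subset H.

(** * Normal subgroups and metabelian groups of the class *)

Section YnBasics.

Variable gT : finGroupType.
Implicit Types G H M N : {group gT}.

Lemma Yn_sub G H : Yn G -> H \subset G -> Yn H.
Proof.
move=> YG sHG K sKH nabK; apply: subset_trans (YG K (subset_trans sKH sHG) nabK).
exact: setSI.
Qed.

Lemma Yn_normal G H : Yn G -> H <| G -> ~~ abelian H -> H :=: G.
Proof.
move=> YG /andP[sHG nHG] nabH; apply/eqP; rewrite eqEsubset sHG.
by rewrite -{1}(setIidPl nHG) YG.
Qed.

(** Proper subgroups of a nilpotent group are smaller than their normalizers, whereas H is its own
    normalizer in G. *)
Lemma Yn_nilpotent_quo G N H : Yn G -> N <| G -> nilpotent (G / N) ->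
  N \subset H -> H \subset G -> ~~ abelian H -> H :=: G.
Proof.
move=> YG nsNG nilGN sNH sHG nabH; have nsNH := normalS sNH sHG nsNG.
apply/eqP; rewrite eqEproper sHG; apply/negP=> prHG.
have : H / N \proper G / N by rewrite quotient_proper // normalS.
move/(nilpotent_proper_norm nilGN); rewrite -quotient_subnormG //.
by rewrite properE => /andP[_ /negP[]]; rewrite quotientS // YG.
Qed.

Lemma Yn_quo G M : Yn G -> M <| G -> Yn (G / M).
Proof.
move=> YG nsMG Hb sHG nabH; have [H defH sMH sHG'] := inv_quotientS nsMG sHG.
have nsMH : M <| H := normalS sMH sHG' nsMG.
rewrite defH in nabH *; rewrite -quotient_subnormG // quotientS // YG //.
by apply: contra nabH => abH; exact: quotient_abelian.
Qed.

Lemma Yn_pgroup_proper (r : nat) G H : Yn G -> r.-group G -> H \proper G -> abelian H.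
Proof.
move=> YG rG prHG; apply: contraLR prHG => nabH; rewrite properE negb_and negbK.
have [sHG|//] := boolP (H \subset G); rewrite orbC.
have -> := @Yn_nilpotent_quo G 1%G H YG (normal1 _) _ (sub1G _) sHG nabH.
  by rewrite subxx.
exact: quotient_nil (pgroup_nil rG).
Qed.

Lemma Yn_der1 G : Yn G -> ~~ abelian G^`(1) -> G^`(1) = G.
Proof. by move=> YG; apply: Yn_normal YG (der_normal 1 G). Qed.

Section Metabelian.

Variable G : {group gT}.
Hypothesis (YG : Yn G) (metaG : abelian G^`(1)) (nabG : ~~ abelian G).

(** A is a maximal normal subgroup, abelian by [Yn_normal], of prime index by solvability; B is its
    p'-core. *)
Lemma Yn_metabelian_index : exists p, exists A : {group gT}, exists B : {group gT},
  [/\ prime p, [/\ A <| G, abelian A & #|G : A| = p],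
      B <| G, B \subset A & p^'.-group B /\ p.-group (G / B)].
Proof.
have solG : solvable G.
  by rewrite (series_sol (der_normal 1 G)) !abelian_sol // sub_der1_abelian.
have ntG : G :!=: 1 by apply: contraNneq nabG => ->; exact: abelian1.
have [A maxA] := ex_maxnormal_ntrivg ntG.
have nsAG := maxnormal_normal maxA; have prA := maxnormal_proper maxA.
have abA : abelian A.
  apply: contraLR prA => nabA.
  by rewrite (Yn_normal YG nsAG nabA) properxx.
have p_pr := index_maxnormal_sol_prime solG maxA.
set p := #|G : A| in p_pr.
exists p, A, 'O_p^'(A)%G; split=> //.
- by rewrite gFnormal_trans.
- exact: pcore_sub.
split; first exact: pcore_pgroup.
have nsBG : 'O_p^'(A) <| G by rewrite gFnormal_trans.
rewrite /pgroup card_quotient ?normal_norm //.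
rewrite -(Lagrange_index (normal_sub nsAG) (pcore_sub _ _)) pnatM -/p pnat_id //=.
have /dprod_card cA := nilpotent_pcoreC p (abelian_nil abA).
rewrite -divgS ?pcore_sub // -cA mulnK ?cardG_gt0 //; exact: pcore_pgroup.
Qed.

(** For x in R outside A, A<x> = G and r = p; so C_B(x) centralizes G, lies in N_G(R) = R, and is
    trivial. If B were nontrivial, B<x> would be nonabelian, hence G, and R would embed in the
    cyclic group G / B. *)
Lemma Yn_metabelian_pgroup (r : nat) (R : {group gT}) :
  R \subset G -> r.-group R -> ~~ abelian R -> r.-group G.
Proof.
move=> sRG rR nabR.
have [p [A [B [p_pr [nsAG abA iA] nsBG sBA [p'B pGB]]]]] := Yn_metabelian_index.
have nsRA : ~~ (R \subset A) by apply: contra nabR => sRA; exact: abelianS abA.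
have [x Rx notAx] := subsetPn nsRA; have Gx := subsetP sRG x Rx.
have maxA : maximal A G by apply: p_index_maximal (normal_sub nsAG) _; rewrite iA.
have def_r : r = p.
  have : r.-nat p.
    rewrite -iA -card_quotient ?normal_norm // -(mulg_normal_maximal nsAG maxA sRG) //.
    by rewrite quotientMidl; exact: quotient_pgroup rR.
  by rewrite pnatE // => /eqP.
rewrite def_r in rR *.
have tiBR : B :&: R = 1 by rewrite setIC coprime_TIg //; exact: pnat_coprime rR p'B.
have nBG := normal_norm nsBG; have sBG := normal_sub nsBG.
have [B1|ntB] := eqVneq (gval B) 1.
  by move: pGB; rewrite pquotient_pgroup // B1 pgroup1.
have defG : A * <[x]> = G.
  by apply: mulg_normal_maximal; rewrite ?cycle_subG.
have CBx : 'C_B[x] = 1.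
  apply/trivgP; rewrite -tiBR subsetI subsetIl /=.
  apply/subsetP=> y /setIP[By cxy]; apply: (subsetP (YG sRG nabR)).
  rewrite inE (subsetP sBG) //=.
  have cGy : y \in 'C(G).
    rewrite -defG centM inE (subsetP (subset_trans sBA abA)) //=.
    by rewrite cent_cycle.
  by apply: subsetP cGy; rewrite (subset_trans (centS sRG)) ?cent_sub.
have defG' : B <*> <[x]> = G.
  apply: Yn_nilpotent_quo YG nsBG (pgroup_nil pGB) (joing_subl _ _) _ _.
    by rewrite join_subG sBG cycle_subG.
  apply: contra ntB => abBx; rewrite -subG1 -CBx subsetI subxx /=.
  rewrite sub_cent1 (subsetP (subset_trans (joing_subr B <[x]>) _)) ?cycle_id //.
  by apply: subset_trans abBx _; rewrite centS ?joing_subl.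
case/negP: nabR; rewrite (isog_abelian (quotient_isog (subset_trans sRG nBG) tiBR)).
apply: abelianS (quotientS B sRG) _; rewrite -defG' quotientYidl ?cycle_subG //.
  by rewrite quotient_abelian ?cycle_abelian.
exact: subsetP Gx.
Qed.

End Metabelian.

End YnBasics.

Section MetabelianSdprod.
Variables (gT : finGroupType) (G : {group gT}).
Hypothesis (YG : Yn G) (metaG : abelian G^`(1)) (nabG : ~~ abelian G).
Hypothesis sylG : forall (r : nat) (R : {group gT}),
  R \subset G -> r.-group R -> abelian R.

(** A Sylow p-subgroup P is abelian and complements B; any x in P not centralizing B gives B<x> = G.
    Now [B, x]<x> is normal and nonabelian, so [B, x] = B, and coprime action gives C_B(x) = 1.
    Finally x^p lies in A, which centralizes B. *)
Lemma Yn_metabelian_sdprod : exists p, exists2 B : {group gT},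
    [/\ prime p, B <| G, abelian B, p^'.-group B & p.-group (G / B)] &
    exists x, [/\ x \in G, p.-elt x, B ><| <[x]> = G, 'C_B[x] = 1 & x ^+ p \in 'Z(G)].
Proof.
have [p [A [B [p_pr [nsAG abA iA] nsBG sBA [p'B pGB]]]]] :=
  Yn_metabelian_index YG metaG nabG.
have abB := abelianS sBA abA.
have [nBG sBG] := (normal_norm nsBG, normal_sub nsBG).
have hallB : p^'.-Hall(G) B.
  rewrite /pHall sBG p'B /= pnatNK -card_quotient //; exact: pGB.
have [P sylP] := Sylow_exists p G; have sPG := pHall_sub sylP.
have pP := pHall_pgroup sylP; have abP := sylG sPG pP.
have sdG : B ><| P = G by apply/(sdprod_normal_pHallP nsBG sylP).
have [_ defG _ tiBP] := sdprodP sdG.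
have nBP := subset_trans sPG nBG.
have [x Px ncBx] : exists2 x, x \in P & ~~ (x \in 'C(B)).
  apply/subsetPn; apply: contra nabG => cBP.
  by rewrite -defG abelianM abB abP.
have Gx := subsetP sPG x Px.
have px : p.-elt x := mem_p_elt pP Px.
have sxG : <[x]> \subset G by rewrite cycle_subG.
have nBx : <[x]> \subset 'N(B) := subset_trans sxG nBG.
have defG' : B <*> <[x]> = G.
  apply: Yn_nilpotent_quo YG nsBG (pgroup_nil pGB) (joing_subl _ _) _ _.
    by rewrite join_subG sBG.
  apply: contra ncBx => abBx; rewrite -cycle_subG.
  by rewrite (subset_trans (joing_subr B <[x]>)) // (subset_trans abBx) // centS ?joing_subl.
have tiBx : B :&: <[x]> = 1.
  by apply/trivgP; rewrite -tiBP setIS // cycle_subG.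
have sdG' : B ><| <[x]> = G by rewrite sdprodEY.
have coBx : coprime #|B| #|<[x]>| by rewrite coprime_sym; exact: pnat_coprime px p'B.
pose K := [~: B, <[x]>]%G.
have sKB : K \subset B by rewrite commg_subl.
have nKG : G \subset 'N(K).
  by rewrite -defG' join_subG; apply/andP; split; [exact: commg_norml | exact: commg_normr].
have defK : K :=: B.
  have nKxB : B \subset 'N(K <*> <[x]>).
    apply/subsetP=> b Bb; rewrite inE conjYg -cycleJ join_subG.
    rewrite (normP (subsetP nKG _ (subsetP sBG b Bb))) joing_subl cycle_subG.
    rewrite conjg_mulR groupM //; first by rewrite mem_gen // inE cycle_id orbT.
    by rewrite (subsetP (joing_subl K _)) //= commGC mem_commg ?cycle_id.
  have nsKxG : K <*> <[x]> <| G.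
    rewrite /normal join_subG (subset_trans sKB) // sxG /= -{1}defG'.
    by rewrite join_subG nKxB (subset_trans (joing_subr K <[x]>)) ?normG.
  have KxG : K <*> <[x]> = G.
    apply: (Yn_normal YG nsKxG); apply: contra ncBx => abKx.
    have K1 : K :=: 1.
      rewrite -(coprime_abel_cent_TI nBx coBx abB); apply/esym/setIidPl.
      rewrite (subset_trans (joing_subl K <[x]>)) // (subset_trans abKx) //.
      by rewrite centS ?joing_subr.
    by rewrite -cycle_subG centsC; apply/commG1P.
  have := group_modl <[x]> sKB.
  rewrite setIC tiBx mulg1 -norm_joinEr ?(subset_trans sxG) // KxG => ->.
  by rewrite (setIidPr sBG).
have CBx : 'C_B[x] = 1.
  by rewrite -cent_cycle -{1}defK; exact: coprime_abel_cent_TI.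
exists p, B => //; exists x; split=> //.
have Axp : x ^+ p \in A.
  have nAx := subsetP (normal_norm nsAG) x Gx.
  apply: coset_idr; first exact: groupX.
  rewrite morphX // -iA -card_quotient ?normal_norm //.
  by rewrite expg_cardG ?mem_quotient.
rewrite inE groupX //= -defG' centY inE (subsetP (subset_trans abA (centS sBA))) //=.
  by rewrite cent_cycle groupX ?cent1id.
Qed.
End MetabelianSdprod.

(** * Fusion and transfer in perfect groups *)

Lemma Sylow_fusion_norm (gT : finGroupType) (G P Q : {group gT}) r x g :
    x \in G -> r.-Sylow('C_G[x]) P -> r.-Sylow('C_G[x ^ g]) Q -> g \in G ->
  exists2 h, h \in G & P :^ h = Q /\ x ^ h = x ^ g.
Proof.
move=> Gx sylP sylQ Gg.
have sylPg : r.-Sylow('C_G[x ^ g]) (P :^ g)%G.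
  by rewrite -{1}(conjGid Gg) cent1J -conjIg pHallJ2.
have [c /setIP[Gc cxg] defQ] := Sylow_trans sylPg sylQ.
exists (g * c); first exact: groupM.
by rewrite conjsgM conjgM -defQ; split=> //; rewrite [LHS]conjgE -(cent1P cxg) mulKg.
Qed.

(** Conjugation in R is trivial modulo R', so an x in R outside R' would contradict
    [transfer_focal]. *)
Lemma perfect_focal (gT : finGroupType) (G R : {group gT}) r :
    G^`(1) = G -> r.-Sylow(G) R ->
    {in R, forall x, {in G, forall g, x ^ g \in R ->
       exists2 h, h \in R & x ^ h = x ^ g}} ->
  R :=: 1.
Proof.
move=> perfG sylR fus; have sRG := pHall_sub sylR.
apply/eqP/idPn=> ntR; have solR := nilpotent_sol (pgroup_nil (pHall_pgroup sylR)).
have /properP[_ [x Rx /negP[]]] := sol_der1_proper solR (subxx R) ntR.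
apply: (transfer_focal sylR Rx); first by rewrite perfG (subsetP sRG).
move=> n g Gg Rxg; have Rxn : x ^+ n \in R by rewrite groupX.
have [h Rh <-] := fus _ Rxn g Gg Rxg.
by rewrite conjg_mulR coset_kerr // mem_commg.
Qed.

(** Burnside's transfer theorem. The abelian R is Sylow in the centralizer of each of its elements,
    so fusion in R takes place in N_G(R), which centralizes R. *)
Lemma Burnside_perfect (gT : finGroupType) (G R : {group gT}) r :
  G^`(1) = G -> r.-Sylow(G) R -> 'N_G(R) \subset 'C(R) -> R :=: 1.
Proof.
move=> perfG sylR cNR; have sRG := pHall_sub sylR.
have abR : abelian R by apply: subset_trans cNR; rewrite subsetI sRG normG.
apply: (perfect_focal perfG sylR) => x Rx g Gg Rxg; have Gx := subsetP sRG x Rx.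
have sylC y : y \in R -> r.-Sylow('C_G[y]) R.
  move=> Ry; apply: (pHall_subl _ _ sylR); last exact: subsetIl.
  by rewrite subsetI sRG sub_cent1 (subsetP abR).
have [h Gh [defR <-]] := Sylow_fusion_norm Gx (sylC x Rx) (sylC _ Rxg) Gg.
exists 1 => //; rewrite conjg1; apply/esym/conjg_fixP/commgP.
have : h \in 'C(R) by apply: (subsetP cNR); rewrite inE Gh; apply/normP.
by move/centP/(_ x Rx)/commute_sym.
Qed.

(** * Simple groups of the class with metabelian local subgroups *)

Section LocalYn.

Variables (gT : finGroupType) (F : {group gT}).
Hypotheses (YF : Yn F) (simF : simple F) (nabF : ~~ abelian F).
Hypothesis locF : forall D : {group gT}, D \subset F -> D :!=: 1 -> abelian D ->
  abelian ('N_F(D))^`(1).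

Lemma simple_perfect : F^`(1) = F.
Proof.
have /simpleP[_ simF'] := simF.
have [/derG1P abF|//] := simF' _ (der_normal 1 F).
by have := nabF; rewrite abF.
Qed.

(** If M = C_R(x) is proper, it is maximal in R, hence normal in R. The metabelian N_F(M) contains
    the nonabelian r-group R, so it is an r-group, and R is Sylow. *)
Lemma nonabelian_Sylow_norm_cent1 (r : nat) (R : {group gT}) x : r.-Sylow(F) R ->
  ~~ abelian R -> x \in R -> 'N_F('C_R[x]) = R.
Proof.
move=> sylR nabR Rx; have sRF := pHall_sub sylR; have rR := pHall_pgroup sylR.
have NR : 'N_F(R) = R.
  by apply/eqP; rewrite eqEsubset YF // subsetI sRF normG.
have [cRx|ncRx] := boolP (R \subset 'C[x]); first by rewrite (setIidPl cRx).
pose M := 'C_R[x]%G.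
have prM : M \proper R by rewrite properE subsetIl subsetI subxx.
have abM : abelian M := Yn_pgroup_proper (Yn_sub YF sRF) rR prM.
have [L maxL sML] := maxgroup_exists (prM : (fun H : {group gT} => H \proper R) M).
have LM : M :=: L.
  apply/eqP; rewrite eqEsubset sML subsetI (proper_sub (maxgroupp maxL)) sub_cent1.
  have abL := Yn_pgroup_proper (Yn_sub YF sRF) rR (maxgroupp maxL).
  by rewrite (subsetP abL) // (subsetP sML) // inE Rx cent1id.
have nsMR : M <| R by rewrite LM; apply: p_maximal_normal rR _.
have sRN : R \subset 'N_F(M) by rewrite subsetI sRF normal_norm.
have ntM : M :!=: 1.
  apply: contraNneq ncRx => M1; have : x \in M by rewrite inE Rx cent1id.
  by rewrite M1 => /set1P->; rewrite sub_cent1 group1.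
have metaN : abelian ('N_F(M))^`(1).
  by apply: locF => //; exact: subset_trans (proper_sub prM) sRF.
have rN : r.-group 'N_F(M).
  apply: (Yn_metabelian_pgroup _ metaN _ sRN rR nabR); first exact: Yn_sub YF (subsetIl _ _).
  by apply: contra nabR; exact: abelianS.
apply/eqP; rewrite eqEsubset sRN andbT.
by rewrite (sub_pHall sylR rN sRN (subsetIl _ _)).
Qed.

(** For a nonabelian Sylow subgroup P, C_P(x) is Sylow in C_F(x), since N_F(C_P(x)) = P. An h
    carrying C_P(x) to C_P(x^g) therefore normalizes P and lies in P; so [perfect_focal] applies. *)
Lemma pgroup_abelian (r : nat) (R : {group gT}) : R \subset F -> r.-group R -> abelian R.
Proof.
move=> sRF rR; have [P sylP sRP] := Sylow_superset sRF rR.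
apply: abelianS sRP _; apply/idPn=> nabP.
have NC x : x \in P -> 'N_F('C_P[x]) = P := nonabelian_Sylow_norm_cent1 sylP nabP.
have sPF := pHall_sub sylP; have pP := pHall_pgroup sylP.
have sylC x : x \in P -> r.-Sylow('C_F[x]) 'C_P[x].
  move=> Px; have sCF : 'C_P[x] \subset 'C_F[x] by rewrite setSI.
  have [Q sylQ sCQ] := Sylow_superset sCF (pgroupS (subsetIl P 'C[x]) pP).
  suff -> : 'C_P[x] = Q by [].
  apply/eqP; rewrite eqEproper sCQ; apply/negP=> prCQ.
  have := nilpotent_proper_norm (pgroup_nil (pHall_pgroup sylQ)) prCQ.
  rewrite properE => /andP[_ /negP[]]; rewrite subsetI.
  have /subsetIP[sQF sQC] := pHall_sub sylQ.
  rewrite (subset_trans (setSI 'N('C_P[x]) sQF)) ?(NC x Px) ?subxx /=//.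
  by rewrite subIset ?sQC.
suff P1 : P :=: 1 by rewrite P1 abelian1 in nabP.
apply: (perfect_focal simple_perfect sylP) => x Px g Fg Pxg.
have [h Fh [defC <-]] :=
  Sylow_fusion_norm (subsetP sPF x Px) (sylC x Px) (sylC _ Pxg) Fg.
exists h => //; rewrite -(NC 1 (group1 P)) inE Fh.
have -> : 'C_P[1] = P by apply/setIidPl; rewrite sub_cent1 group1.
apply/normP; rewrite -{1}(NC x Px) conjIg conjGid // -normJ defC.
exact: NC.
Qed.

(** A nonabelian C = C_F(z) contains N_F(<z>) and is B : <x> with z in <x>. A Sylow p-subgroup
    containing x is abelian, so it lies in C and equals <x>. Its normalizer normalizes <z>, lies in
    C, and is <x>, against Burnside's theorem. *)
Lemma CA_group_Yn : CA_group F.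
Proof.
move=> z F1z; apply/idPn=> nabC; have [z1 Fz] := setD1P F1z.
pose C := 'C_F[z]%G; have sCF : C \subset F := subsetIl _ _.
have nCN : 'N_F(<[z]>) \subset C.
  apply: subset_trans (YF sCF nabC); rewrite subsetI subsetIl /= -cent_cycle.
  by rewrite normsI ?norms_cent ?subsetIr // subIset ?normG.
have sCN : C \subset 'N_F(<[z]>) by rewrite /= -cent_cycle setIS ?cent_sub.
have metaC : abelian C^`(1).
  apply: abelianS (dergS 1 sCN) _; apply: locF; rewrite ?cycle_subG ?cycle_abelian //.
  by rewrite cycle_eq1.
have [p [B [p_pr nsBC abB p'B pCB] [x [Cx px sdC CBx _]]]] :=
  Yn_metabelian_sdprod (Yn_sub YF sCF) metaC nabC
    (fun r R sRC => @pgroup_abelian r R (subset_trans sRC sCF)).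
have [_ defC nBx tiBx] := sdprodP sdC.
have xz : z \in <[x]>.
  have : z \in C by rewrite inE Fz cent1id.
  rewrite -defC => /mulsgP[b y Bb xy def_z].
  suff b1 : b \in 'C_B[x] by move: b1; rewrite CBx def_z => /set1P->; rewrite mul1g.
  rewrite inE Bb (_ : b = z * y^-1); last by rewrite def_z mulgK.
  have cxz : z \in 'C[x] by rewrite cent1C; case/setIP: Cx.
  have cxy : y \in 'C[x] by rewrite -cent_cycle (subsetP (cycle_abelian x)).
  by rewrite groupM ?groupV.
have Fx := subsetP sCF x Cx.
have sxF : <[x]> \subset F by rewrite cycle_subG.
have [P sylP sxP] := Sylow_superset sxF px.
have abP := pgroup_abelian (pHall_sub sylP) (pHall_pgroup sylP).
have sylx : p.-Sylow(C) <[x]>.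
  rewrite /pHall cycle_subG Cx -divgS ?cycle_subG // -(sdprod_card sdC) mulnK ?cardG_gt0 //=.
  by apply/andP; split; [exact: px | exact: p'B].
have sPC : P \subset C.
  by rewrite subsetI (pHall_sub sylP) sub_cent1 (subsetP abP) // (subsetP sxP).
have defP : P :=: <[x]> := sub_pHall sylx (pHall_pgroup sylP) sxP sPC.
have NP : 'N_F(P) \subset P.
  have sNC : 'N_F(P) \subset C.
    apply: subset_trans nCN; rewrite setIS // char_norms // defP.
    by rewrite cycle_subgroup_char // cycle_subG.
  apply/subsetP=> n NPn; have := subsetP sNC n NPn.
  rewrite -{1}defC => /mulsgP[b y Bb xy def_n].
  suff b1 : b \in 'C_B[x] by move: b1; rewrite CBx def_n => /set1P->; rewrite mul1g defP.
  have nb : b \in 'N(<[x]>).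
    have -> : b = n * y^-1 by rewrite def_n mulgK.
    rewrite groupM ?groupV //; first by move: NPn; rewrite defP => /setIP[].
    exact: subsetP (normG _) y xy.
  rewrite inE Bb; apply/cent1P/commgP; rewrite -in_set1 -[[set 1]]tiBx inE; apply/andP; split.
    by rewrite commgEl groupM ?groupV // memJ_norm // (subsetP nBx) ?cycle_id.
  by rewrite commgEr groupM ?cycle_id // memJ_norm ?groupV ?cycle_id.
have : P :=: 1.
  apply: Burnside_perfect simple_perfect sylP _.
  exact: subset_trans NP abP.
rewrite defP => /eqP; rewrite cycle_eq1 => /eqP x1.
by move: xz; rewrite x1 cycle1 inE (negPf z1).
Qed.

(** Were A self-normalizing, a nontrivial Sylow subgroup of A would be Sylow in F, and by the TI
    property its normalizer would lie in A, which centralizes it. *)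
Lemma cent1_abelian_normal x (A := 'C_F[x]%G) : x \in F^# ->
  ~~ ('N_F(A) \subset A).
Proof.
move=> F1x; apply/negP=> NA; have [x1 Fx] := setD1P F1x.
have abA : abelian A := CA_group_Yn F1x.
have Ax : x \in A by rewrite inE Fx cent1id.
have A1 : 1 < #|A|.
  by rewrite cardG_gt1; apply: contraNneq x1 => A1; rewrite A1 inE in Ax.
pose r := pdiv #|A|; have [R sylR] := Sylow_exists r A.
have ntR : R :!=: 1.
  rewrite -cardG_gt1 (card_Hall sylR) p_part_gt1 mem_primes pdiv_prime //.
  by rewrite cardG_gt0 pdiv_dvd.
have [y Ry y1] := trivgPn _ ntR; have sRA := pHall_sub sylR.
have sAF : A \subset F := subsetIl _ _.
have [Q sylQ sRQ] := Sylow_superset (subset_trans sRA sAF) (pHall_pgroup sylR).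
have Ay : y \in A^# by rewrite in_setD1 y1 (subsetP sRA).
have Cy : 'C_F[y] = A := cent1_CA CA_group_Yn F1x Ay.
have abQ := pgroup_abelian (pHall_sub sylQ) (pHall_pgroup sylQ).
have sQA : Q \subset A.
  by rewrite -Cy subsetI (pHall_sub sylQ) sub_cent1 (subsetP abQ) // (subsetP sRQ).
have defQ : Q :=: R := sub_pHall sylR (pHall_pgroup sylQ) sRQ sQA.
case/eqP: ntR; rewrite -defQ; apply: Burnside_perfect simple_perfect sylQ _.
apply: subset_trans (subset_trans abA (centS sQA)); apply: subset_trans NA.
apply/subsetP=> n /setIP[Fn nQn].
have [_ _ memJ] := normedTI_memJ_P (normedTI_cent1 CA_group_Yn F1x).
rewrite -(memJ y) // in_setD1 conjg_eq1 y1 (subsetP sQA) // memJ_norm //.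
exact: subsetP sRQ y Ry.
Qed.

(** N_F(A) = B : <y> has trivial center, as it lies in no abelian centralizer; hence y^p = 1 and B
    has index p. A meets B nontrivially, so B lies in A, and maximality of B gives A = B. *)
Lemma cent1_index_prime x (A := 'C_F[x]%G) : x \in F^# -> prime #|'N_F(A) : A|.
Proof.
move=> F1x; have [x1 Fx] := setD1P F1x; have nsN := cent1_abelian_normal F1x.
have abA : abelian A := CA_group_Yn F1x.
have sAF : A \subset F := subsetIl _ _.
have Ax : x \in A by rewrite inE Fx cent1id.
have sNF : 'N_F(A) \subset F := subsetIl _ _.
have nabN : ~~ abelian 'N_F(A).
  apply: contra nsN => abN; rewrite subsetI sNF sub_cent1.
  by rewrite (subsetP abN) // inE Fx (subsetP (normG A)).
have metaN : abelian ('N_F(A))^`(1).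
  by apply: locF => //; apply: contraNneq x1 => A1; rewrite A1 inE in Ax.
have [p [B [p_pr nsBN abB p'B pNB] [y [Ny py sdN CBy Zyp]]]] :=
  Yn_metabelian_sdprod (Yn_sub YF sNF) metaN nabN
    (fun r R sRN => @pgroup_abelian r R (subset_trans sRN sNF)).
have [_ defN nBy tiBy] := sdprodP sdN.
have sBN := normal_sub nsBN.
have ZN z : z \in 'Z('N_F(A)) -> z = 1.
  case/centerP=> Nz cNz; apply/eqP; apply: contraNT nabN => z1.
  have F1z : z \in F^# by rewrite in_setD1 z1 (subsetP sNF).
  apply: abelianS (CA_group_Yn F1z); rewrite subsetI sNF.
  by apply/subsetP=> n Nn; apply/cent1P/commute_sym/cNz.
have oy : #[y] = p.
  apply: nt_prime_order p_pr (ZN _ Zyp) _; apply: contraNneq nabN => y1.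
  by rewrite -defN y1 cycle1 mulg1.
have ntB : B :!=: 1.
  by apply: contraNneq nabN => B1; rewrite -defN B1 mul1g cycle_abelian.
have nsAN : A <| 'N_F(A) by exact: normalSG.
have nBA : A \subset 'N(B) := subset_trans (normal_sub nsAN) (normal_norm nsBN).
have nAB : B \subset 'N(A) := subset_trans sBN (normal_norm nsAN).
have sBA_cent : B \subset 'C(A) -> B \subset A.
  move=> cAB; rewrite subsetI (subset_trans sBN) //= sub_cent1.
  by move: cAB; rewrite centsC => /subsetP/(_ x Ax).
have [b b1 [Ab Bb]] : exists2 b, b != 1 & b \in A /\ b \in B.
  have : A :&: B != 1.
    apply: contra ntB => /eqP tiAB; rewrite -subG1 -tiAB subsetI subxx andbT.
    apply: sBA_cent; rewrite centsC; apply/commG1P/trivgP.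
    by rewrite -tiAB subsetI commg_subl nAB commg_subr nBA.
  by case/trivgPn=> b /setIP[Ab Bb] b1; exists b.
have Cb : 'C_F[b] = A by apply: (cent1_CA CA_group_Yn F1x); rewrite in_setD1 b1.
have sBA : B \subset A.
  by rewrite -Cb subsetI (subset_trans sBN) //= sub_cent1 (subsetP abB).
have defA : A :=: B.
  have maxB : maximal B 'N_F(A).
    by apply: p_index_maximal sBN _; rewrite -(index_sdprod sdN) -orderE oy.
  have prAN : A \proper 'N_F(A).
    rewrite properEneq normal_sub // andbT; apply: contraNneq nabN => <-.
    exact: abA.
  by have [_ /(_ _ prAN sBA)] := maxgroupP maxB.
rewrite (_ : #|_ : _| = #|'N_F(A) : B|); last by rewrite -defA.
by rewrite -(index_sdprod sdN) -orderE oy.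
Qed.

End LocalYn.

Lemma simple_normal (gT : finGroupType) (G H : {group gT}) :
  simple G -> H <| G -> abelian H -> ~~ abelian G -> H :=: 1.
Proof.
case/simpleP=> _ simG nsHG abH nabG.
by case: (simG H nsHG) => // defH; rewrite -defH abH in nabG.
Qed.

(** * Nonmetabelian groups of the class are simple *)

Section Nonmetabelian.

Variables (gT : finGroupType) (F : {group gT}).
Hypotheses (YF : Yn F) (nmF : ~~ abelian F^`(1)).
Hypothesis IH : forall H : {group gT}, H \proper F -> ~~ abelian H^`(1) -> simple H.

(* If M <> 1, minimality makes all local subgroups of F / M metabelian.  The preimage H
   of the normalizer of a centralizer is B : <x>, and every normal subgroup of F
   containing B is F, which forces M to be a central p-group; transfer excludes that. *)
Lemma quotient_maxnormal_trivial (M : {group gT}) : maxnormal M F F -> M :=: 1.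
Proof.
move=> maxM; have nsMF := maxnormal_normal maxM.
have [sMF nMF] := andP nsMF; have prM := maxnormal_proper maxM.
have perfF : F^`(1) = F := Yn_der1 YF nmF.
have abM : abelian M.
  by apply: contraLR prM => nabM; rewrite (Yn_normal YF nsMF nabM) properxx.
apply/eqP/idPn=> ntM.
have metaH (H : {group gT}) : M \subset H -> H \proper F -> abelian H^`(1).
  move=> sMH prH; apply: contraR ntM => nmH.
  have simH := IH prH nmH; apply/eqP; apply: simple_normal simH _ abM _.
    exact: normalS (proper_sub prH) nsMF.
  by apply: contra nmH => abH; rewrite (derG1P abH) abelian1.
have perfFb : (F / M)^`(1) = F / M by rewrite -quotient_der // perfF.
have simFb : simple (F / M) by rewrite quotient_simple.
have nabFb : ~~ abelian (F / M).
  apply: contraL prM => abFb; rewrite properE negb_and negbK orbC.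
  by rewrite -{1}perfF der1_min.
have YFb := Yn_quo YF nsMF.
have normFb (D : {group coset_of M}) : D \subset F / M -> D :!=: 1 -> abelian D ->
    exists2 H : {group gT}, M \subset H /\ H \proper F & 'N_(F / M)(D) = H / M.
  move=> sDF ntD abD.
  have [H defH sMH sHF] := inv_quotientS nsMF (subsetIl (F / M) 'N(D)).
  exists H => //; split=> //; rewrite properEneq sHF andbT.
  apply: contraNneq ntD => HF; apply/eqP; apply: simple_normal simFb _ abD nabFb.
  rewrite /normal sDF; have : F / M \subset 'N_(F / M)(D) by rewrite defH HF.
  by rewrite subsetI => /andP[].
have locFb (D : {group coset_of M}) : D \subset F / M -> D :!=: 1 -> abelian D ->
    abelian ('N_(F / M)(D))^`(1).
  move=> sDF ntD abD; have [H [sMH prH] ->] := normFb D sDF ntD abD.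
  rewrite -quotient_der ?(subset_trans (proper_sub prH)) //.
  by rewrite quotient_abelian ?metaH.
have sylFb := pgroup_abelian YFb simFb nabFb locFb.
have [xb Fbx xb1] : exists2 x, x \in F / M & x != 1.
  by apply/trivgPn; apply: contraNneq nabFb => ->; exact: abelian1.
have Fb1x : xb \in (F / M)^# by rewrite in_setD1 xb1.
have abC : abelian 'C_(F / M)[xb] := CA_group_Yn YFb simFb nabFb locFb Fb1x.
have [H [sMH prH] defH] : exists2 H : {group gT},
    M \subset H /\ H \proper F & 'N_(F / M)('C_(F / M)[xb]) = H / M.
  apply: (normFb 'C_(F / M)[xb]%G) => //; first exact: subsetIl.
  by apply/trivgPn; exists xb; rewrite // inE Fbx cent1id.
have sHF := proper_sub prH; have nMH := subset_trans sHF nMF.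
have nabHb : ~~ abelian (H / M).
  have := cent1_abelian_normal YFb simFb nabFb locFb Fb1x.
  apply: contra => abN; rewrite subsetI subsetIl sub_cent1 defH.
  rewrite (subsetP abN) // -defH inE Fbx.
  by rewrite (subsetP (normG _)) // inE Fbx cent1id.
have nabH : ~~ abelian H by apply: contra nabHb; exact: quotient_abelian.
have sylH (r : nat) (R : {group gT}) : R \subset H -> r.-group R -> abelian R.
  move=> sRH rR; apply: contraR nabHb => nabR.
  have rH := Yn_metabelian_pgroup (Yn_sub YF sHF) (metaH H sMH prH) nabH sRH rR nabR.
  by apply: sylFb (quotient_pgroup _ rH); exact: quotientS.
have [p [B [p_pr nsBH abB p'B pHB] [x [Hx px sdH CBx _]]]] :=
  Yn_metabelian_sdprod (Yn_sub YF sHF) (metaH H sMH prH) nabH sylH.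
have [_ defBx nBx tiBx] := sdprodP sdH.
have nBM : ~~ (B \subset M).
  apply: contra nabHb => sBM; rewrite -defBx quotientMl; last first.
    exact: subset_trans (normal_sub nsBH) nMH.
  by rewrite (quotientS1 sBM) mul1g quotient_abelian ?cycle_abelian.
have normal_full (K : {group gT}) : K <| F -> B \subset K -> K :=: F.
  move=> nsKF sBK; have [sKF nKF] := andP nsKF.
  have MKF : M <*> K = F.
    apply/eqP; rewrite eqEproper join_subG sMF sKF; apply: contra nBM => prMK.
    have [_ maxM'] := maxgroupP maxM.
    rewrite -(maxM' (M <*> K)%G) ?joing_subl ?(subset_trans sBK) ?joing_subr //.
    by rewrite prMK normsY.
  apply/eqP; rewrite eqEsubset sKF -{1}perfF der1_min // -MKF.
  by rewrite quotientYidr ?(subset_trans sMF) ?quotient_abelian.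
have hallB : p^'.-Hall(H) B.
  have [sBH nBH] := andP nsBH.
  rewrite /pHall sBH p'B /= pnatNK -card_quotient //; exact: pHB.
have M1 : 'O_p^'(M) = 1.
  have sOB : 'O_p^'(M) \subset B.
    rewrite (sub_normal_Hall hallB) ?pcore_pgroup //.
    exact: subset_trans (pcore_sub _ _) sMH.
  have defC : 'C_F('O_p^'(M)) = F.
    apply: (normal_full 'C_F('O_p^'(M))%G).
      have /andP[_ nOF] : 'O_p^'(M) <| F by rewrite gFnormal_trans.
      by have := subcent_normal F 'O_p^'(M); rewrite (setIidPl nOF).
    rewrite subsetI (subset_trans (normal_sub nsBH)) //=.
    by rewrite (subset_trans abB) // centS.
  apply/trivgP; rewrite -CBx subsetI sOB sub_cent1 /=.
  by have := subsetP sHF x Hx; rewrite -{1}defC => /setIP[].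
have pM : p.-group M.
  have := nilpotent_pcoreC p (abelian_nil abM); rewrite M1 dprodg1 => <-.
  exact: pcore_pgroup.
have cMF : M \subset 'C(F).
  rewrite centsC; apply/setIidPl; apply: (normal_full 'C_F(M)%G).
    by have := subcent_normal F M; rewrite (setIidPl nMF).
  rewrite subsetI (subset_trans (normal_sub nsBH)) //=; apply/commG1P/trivgP.
  have coBM : coprime #|B| #|M| by rewrite coprime_sym; exact: pnat_coprime pM p'B.
  have nMB : B \subset 'N(M) := subset_trans (normal_sub nsBH) nMH.
  have nBM' : M \subset 'N(B) := subset_trans sMH (normal_norm nsBH).
  by rewrite -(coprime_TIg coBM) subsetI commg_subl commg_subr nMB nBM'.
have [P sylP] := Sylow_exists p F; have sPF := pHall_sub sylP.
have sMP : M \subset P.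
  by rewrite (subset_trans _ (pcore_sub_Hall sylP)) // pcore_max.
(* If P is abelian, transfer kills the central M. Otherwise P is self-normalizing, and Burnside's
   theorem applies to P / M. *)
have [abP | nabP] := boolP (abelian P).
  case/negP: ntM; rewrite -subG1 -(derG1P abP); apply/subsetP=> m Mm.
  apply: (transfer_focal sylP); rewrite ?perfF ?(subsetP sMP) ?(subsetP sMF) //.
  move=> n g Fg _; congr coset; apply/conjg_fixP/commgP.
  by apply: (centP (subsetP cMF _ (groupX n Mm))).
have nMP := subset_trans sPF nMF.
have sylPb := quotient_pHall nMP sylP.
have NP := YF sPF nabP.
have abPb : abelian (P / M).
  exact: sylFb (pHall_sub sylPb) (pHall_pgroup sylPb).
case/negP: nabP; apply: abelianS abM; rewrite -quotient_sub1 //.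
rewrite (Burnside_perfect perfFb sylPb) //; apply: subset_trans abPb.
by rewrite -quotient_subnormG ?quotientS // (normalS sMP sPF).
Qed.

Lemma Yn_nonmetabelian_simple : simple F.
Proof.
have ntF : F :!=: 1.
  by apply: contraNneq nmF => ->; rewrite (derG1P (abelian1 _)) abelian1.
have [M maxM] := ex_maxnormal_ntrivg ntF.
by rewrite simple_maxnormal -(quotient_maxnormal_trivial maxM).
Qed.

End Nonmetabelian.

Lemma Yn_nonmetabelian (gT : finGroupType) (F : {group gT}) :
  Yn F -> ~~ abelian F^`(1) ->
  simple F /\ forall D : {group gT}, D \subset F -> D :!=: 1 -> abelian D ->
    abelian ('N_F(D))^`(1).
Proof.
have simY (H : {group gT}) : Yn H -> ~~ abelian H^`(1) -> simple H.
  have [n leHn] := ubnP #|H|; elim: n H leHn => // n IHn H leHn YH nmH.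
  apply: (Yn_nonmetabelian_simple YH nmH) => K prK nmK; apply: IHn => //.
    by apply: leq_trans (proper_card prK) _.
  exact: Yn_sub YH (proper_sub prK).
move=> YF nmF; split=> [|D sDF ntD abD]; first exact: simY.
have sNF : 'N_F(D) \subset F := subsetIl _ _.
apply: contraR ntD => nmN; have simN := simY 'N_F(D)%G (Yn_sub YF sNF) nmN.
apply/eqP; apply: simple_normal simN _ abD _; first exact: normalSG.
by apply: contra nmN => abN; rewrite (derG1P abN) abelian1.
Qed.

(** * Groups in which centralisers are abelian, even order *)

(** [i] counts involutions, [g] is |G|, [c] counts the nontrivial elements in conjugates of a
    centralizer of order p. As i (i - p) = p g, the remaining sum [sY] is p g - p c. *)
Lemma even_CA_sum a p c i g sY : 0 < p ->
  (i = p * a.+1)%N -> (g = a.+1 * (a * p))%N -> (2 * p * c = p.-1 * g)%N ->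
  (i * i.+1 = i + i * p + c * p + sY)%N -> (2 * sY = p.+1 * g)%N.
Proof.
move=> p0 eqi eqG eqc; rewrite eqi => eqs.
move: eqs eqc; rewrite eqG -(prednK p0) /=; move: p.-1 => q; lia.
Qed.

(** Eliminating [y] and [c] from (p + 1) g <= 2 (p + 2) y leaves p (p + 2) a^2 <= (p + 1) g, that
    is, (p + 2) a <= (p + 1) (a + 1). *)
Lemma even_CA_arith a p y c i g sY : 0 < p -> 0 < a ->
  (i = p * a.+1)%N -> (g = a.+1 * (a * p))%N -> (2 * p * c = p.-1 * g)%N ->
  (i * i.+1 = i + i * p + c * p + sY)%N ->
  (g = 1 + a.-1 * a.+1 + c + y)%N -> (2 * sY <= 2 * (p + 2) * y)%N -> a <= p.+1.
Proof.
move=> p0 a0 eqi eqG eqc eqs eqg leY.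
have h1 := even_CA_sum p0 eqi eqG eqc eqs.
have h2 : (p * (p.+1 * g) <= p * (2 * (p + 2) * y))%N by rewrite leq_mul2l -h1 leY orbT.
have e1 : (p * y + p * (1 + a.-1 * a.+1 + c) = p * g)%N by rewrite eqg; lia.
have e2 : (p * p * y + p * p * (1 + a.-1 * a.+1 + c) = p * p * g)%N by rewrite eqg; lia.
have e3 : (p * (2 * p * c) = p * (p.-1 * g))%N by rewrite eqc.
suff : (p * a * (a * p.+2) <= p * a * (p.+1 * a.+1))%N.
  rewrite leq_pmul2l ?muln_gt0 ?p0 //; lia.
move: h2 e1 e2 e3 eqc; rewrite eqG -(prednK p0) -(prednK a0) /=.
move: p.-1 a.-1 => q b; lia.
Qed.

Section Involutions.

Variable gT : finGroupType.
Implicit Types s u d : gT.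

Lemma order2P s : reflect (s != 1 /\ s * s = 1) (#[s] == 2).
Proof.
apply: (iffP eqP) => [os | [s1 ss]].
  by rewrite -order_gt1 os -expg2 -os expg_order.
by apply: nt_prime_order; rewrite // expg2.
Qed.

Lemma inv_invg s : #[s] == 2 -> s^-1 = s.
Proof. by case/order2P=> _ ss; rewrite -[LHS]mulg1 -ss mulKg. Qed.

Lemma conjg_invE s d : #[s] == 2 -> (d ^ s == d^-1) = (s * d * (s * d) == 1).
Proof. by move=> s2; rewrite eq_mulgV1 invgK conjgE inv_invg // !mulgA. Qed.

Lemma mul_inv_conj s u : #[s] == 2 -> #[u] == 2 ->
  (s * u) ^ s = (s * u)^-1 /\ (s * u) ^ u = (s * u)^-1.
Proof.
move=> s2 u2; rewrite !conjgE invMg !(inv_invg s2) !(inv_invg u2).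
have [[_ ss] [_ uu]] := (order2P _ s2, order2P _ u2).
by rewrite !mulgA ss mul1g -!mulgA uu mulg1.
Qed.

Lemma odd_mul_inv_conj s u : #[s] == 2 -> #[u] == 2 -> odd #[s * u] ->
  exists2 k, k \in <[s * u]> & s ^ k = u.
Proof.
move=> s2 u2 od; set d := s * u in od *.
have [ds _] := mul_inv_conj s2 u2; have [_ ss] := order2P _ s2.
exists (d ^+ #[d].+1./2); first exact: mem_cycle.
rewrite conjgE -expgVn -ds conjgE inv_invg //.
have -> n : (s * (d * s)) ^+ n = s * d ^+ n * s.
  elim: n => [|n IHn]; first by rewrite !expg0 mulg1 ss.
  by rewrite !expgS IHn !mulgA -(mulgA _ s s) ss mulg1.
rewrite -!mulgA (mulgA s s) ss mul1g -expgD addnn even_halfK /= ?od //.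
by rewrite expgS expg_order mulg1 /d mulgA ss mul1g.
Qed.

End Involutions.

(** * Counting involutions in the cosets of N(A) *)

Section EvenCA.

Variables (gT : finGroupType) (G : {group gT}) (t : gT).
Hypothesis caG : CA_group G.
Hypothesis primeN : {in G^#, forall x, prime #|'N_G('C_G[x]) : 'C_G[x]|}.
Hypothesis properN : {in G^#, forall x, 'N_G('C_G[x]) \proper G}.
Hypotheses (Gt : t \in G) (t2 : #[t] == 2).

Let C x := 'C_G[x]%G.
Let I := [set s in G | #[s] == 2].
Let A := C t.
Let N := 'N_G(A)%G.
Let p := #|N : A|.

Let IG1 s : s \in I -> s \in G^#.
Proof. by rewrite inE => /andP[Gs /order2P[s1 _]]; rewrite in_setD1 s1. Qed.
Let I2 s : s \in I -> #[s] == 2.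
Proof. by rewrite inE => /andP[]. Qed.
Let It : t \in I. Proof. by rewrite inE Gt. Qed.
Let G1t : t \in G^#. Proof. exact: IG1. Qed.
Let p_pr : prime p. Proof. exact: primeN. Qed.
Let sAG : A \subset G. Proof. exact: subsetIl. Qed.
Let sNG : N \subset G. Proof. exact: subsetIl. Qed.
Let nsAN : A <| N. Proof. exact: normalSG. Qed.
Let abA : abelian A. Proof. exact: caG. Qed.
Let CA a : a \in A^# -> 'C_G[a] = A.
Proof. exact: cent1_CA. Qed.
Let memJA a g : a \in A^# -> g \in G -> (a ^ g \in A^#) = (g \in N).
Proof. by have [_ _ memJ] := normedTI_memJ_P (normedTI_cent1 caG G1t); apply: memJ. Qed.
Let IJ s g : s \in I -> g \in G -> s ^ g \in I.
Proof. by rewrite !inE => /andP[Gs s2] Gg; rewrite groupJ // orderJ. Qed.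

(** If s u has even order, the involution in <s u> commutes with s and u, which then have the same
    centralizer. *)
Lemma involution_conj_neq s u : s \in I -> u \in I -> 'C_G[s] != 'C_G[u] ->
  exists2 g, g \in G & s ^ g = u.
Proof.
move=> Is Iu neqC; have [G1s G1u] := (IG1 Is, IG1 Iu).
have [[_ Gs] [_ Gu]] := (setD1P G1s, setD1P G1u).
have [od | ev] := boolP (odd #[s * u]).
  have [k kd sk] := odd_mul_inv_conj (I2 Is) (I2 Iu) od.
  by exists k => //; apply: subsetP kd; rewrite cycle_subG groupM.
pose z := (s * u) ^+ #[s * u]./2.
have zz : z * z = 1 by rewrite -expgD addnn even_halfK // expg_order.
have z1 : z != 1.
  rewrite -order_dvdn gtnNdvd ?half_gt0 //.
    by move: ev; have := order_gt0 (s * u); case: #[_] => [|[|]].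
  by rewrite ltn_half_double -addnn -[X in X < _]addn0 ltn_add2l.
have z2 : #[z] == 2 by apply/order2P.
have G1z : z \in G^# by rewrite in_setD1 z1 groupX ?groupM.
have [ds du] := mul_inv_conj (I2 Is) (I2 Iu).
have zs : s \in 'C_G[z]^#.
  rewrite in_setD1 (proj1 (setD1P G1s)) inE Gs cent1C; apply/cent1P/commgP/conjg_fixP.
  by rewrite conjXg ds expgVn inv_invg.
have zu : u \in 'C_G[z]^#.
  rewrite in_setD1 (proj1 (setD1P G1u)) inE Gu cent1C; apply/cent1P/commgP/conjg_fixP.
  by rewrite conjXg du expgVn inv_invg.
by case/eqP: neqC; rewrite (cent1_CA caG G1z zs) (cent1_CA caG G1z zu).
Qed.

Lemma involution_conj s : s \in I -> exists2 g, g \in G & t ^ g = s.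
Proof.
move=> Is; have [eqC|neqC] := eqVneq ('C_G[s]) 'C_G[t]; last first.
  by apply: involution_conj_neq; rewrite // eq_sym.
have [_ [g Gg notNg]] := properP (properN G1t).
have Itg := IJ It Gg.
have neqA : 'C_G[t] != 'C_G[t ^ g].
  apply: contra notNg => /eqP eqtg; rewrite -/N -(memJA (_ : t \in A^#)) //.
    by rewrite in_setD1 (proj1 (setD1P (IG1 Itg))) /A /C /= eqtg inE cent1id groupJ.
  by rewrite in_setD1 (proj1 (setD1P G1t)) inE Gt cent1id.
have [h Gh <-] : exists2 h, h \in G & (t ^ g) ^ h = s.
  by apply: involution_conj_neq; rewrite // eqC eq_sym.
by exists (g * h); rewrite ?groupM ?conjgM.
Qed.

Lemma card_involutions : #|I| = #|G : A|.
Proof.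
rewrite index_cent1; apply: eq_card => s; apply/idP/imsetP=> [/involution_conj[g Gg <-]|].
  by exists g.
by case=> g Gg ->; exact: IJ.
Qed.

Let At : t \in A^#.
Proof. by rewrite in_setD1 (proj1 (setD1P G1t)) inE Gt cent1id. Qed.

(** By the TI property, involutions of A, being conjugate to t, are conjugate to t under N. *)
Lemma card_involutions_cent : #|I :&: A| = p.
Proof.
have -> : p = #|t ^: N|.
  rewrite -index_cent1; congr #|_ : _|.
  by rewrite -[in LHS](setIidPr (normal_sub nsAN)) /A /C /= setIA (setIidPl sNG).
apply: eq_card => s; apply/setIP/imsetP=> [[Is As]|[n Nn ->]].
  have [g Gg def_s] := involution_conj Is; exists g => //.
  by rewrite -(memJA At Gg) def_s in_setD1 As (proj1 (setD1P (IG1 Is))).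
have Gn := subsetP sNG n Nn; split; first exact: IJ.
by move: (memJA At Gn); rewrite Nn => /setD1P[].
Qed.

(** If p divided |A|, O_p(A) would meet the center of a Sylow p-subgroup P of N in some z <> 1, and
    P would lie in C(z) = A, although p divides |N : A|. *)
Lemma coprime_cent_index : coprime #|A| p.
Proof.
rewrite coprime_sym prime_coprime //; apply/negP=> pA.
have [P sylP] := Sylow_exists p N; have sPN := pHall_sub sylP.
have pP := pHall_pgroup sylP.
have hallQ := nilpotent_pcore_Hall p (abelian_nil abA).
have nsQN : 'O_p(A) <| N by rewrite gFnormal_trans.
have sQP : 'O_p(A) \subset P.
  rewrite (subset_trans _ (pcore_sub_Hall sylP)) //.
  by rewrite pcore_max ?pcore_pgroup.
have ntQ : 'O_p(A) != 1.
  by rewrite -cardG_gt1 (card_Hall hallQ) p_part_gt1 mem_primes p_pr cardG_gt0.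
have nsQP : 'O_p(A) <| P := normalS sQP sPN nsQN.
have /trivgPn[z /setIP[Qz Zz] z1] := meet_center_nil (pgroup_nil pP) nsQP ntQ.
have Az : z \in A^# by rewrite in_setD1 z1 (subsetP (pcore_sub _ _) z Qz).
have sPA : P \subset A.
  rewrite -(CA Az) subsetI (subset_trans sPN) // sub_cent1.
  by case/setIP: Zz.
have := pHall_sub sylP; case/and3P: sylP => _ _.
rewrite -(Lagrange_index (normal_sub nsAN) sPA) pnatM => /andP[p'p _] _.
by move: p'p; rewrite -/p pnatE // inE /= inE eqxx.
Qed.

Lemma index_cent_odd : odd p.
Proof.
have := prime_oddPn p_pr; case: (odd p) => // /(_ isT) p2.
have := coprime_cent_index; rewrite p2 coprimen2 => oddA.
have : #[t] %| #|A| by apply: order_dvdG; case/setD1P: At.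
by rewrite (eqP t2) dvdn2 oddA.
Qed.

Lemma involution_norm_cent s : s \in I -> s \in N -> s \in A.
Proof.
move=> Is Ns.
have hallA : p^'.-Hall(N) A.
  rewrite /pHall normal_sub //= pnatNK -/p pnat_id // andbT.
  by rewrite /pgroup p'natE // -prime_coprime // coprime_sym coprime_cent_index.
rewrite (mem_normal_Hall hallA nsAN Ns) /p_elt (eqP (I2 Is)) pnatE // inE /= inE.
by apply: contraTneq index_cent_odd => <-.
Qed.

(** Elements of A in N^s are p'-elements, so they lie in A^s, which meets A trivially. Hence the
    intersection of N and N^s embeds in N / A. *)
Lemma norm_inter_conj s (X := N :&: N :^ s) : s \in G -> s \notin N ->
  A :&: (N :^ s) = 1 /\ #|X| %| p.
Proof.
move=> Gs nNs.
have hallAs : p^'.-Hall(N :^ s) (A :^ s).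
  rewrite pHallJ2 /pHall normal_sub //= pnatNK -/p pnat_id // andbT.
  by rewrite /pgroup p'natE // -prime_coprime // coprime_sym coprime_cent_index.
have tiA : A :&: (N :^ s) = 1.
  apply/trivgP/subsetP=> u /setIP[Au Nu]; rewrite inE; apply: contraNT nNs => u1.
  have : u \in A :^ s.
    rewrite (mem_normal_Hall hallAs) ?normalJ //.
    apply: mem_p_elt Au; rewrite /pgroup p'natE // -prime_coprime // coprime_sym.
    exact: coprime_cent_index.
  rewrite mem_conjg => Aus.
  have A1u : u \in A^# by rewrite in_setD1 u1.
  rewrite -groupV -(memJA A1u) ?groupV // in_setD1 Aus conjg_eq1 u1 //.
split=> //.
have sXN : X \subset N := subsetIl _ _.
have tiAX : A :&: X = 1 by apply/trivgP; rewrite -tiA setIS // subsetIr.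
have -> : #|X| = #|(N :&: N :^ s)%G / A|.
  by rewrite (card_isog (quotient_isog (subset_trans sXN (normal_norm nsAN)) tiAX)).
by rewrite /p -card_quotient ?normal_norm // cardSg // quotientS.
Qed.

Lemma sub_coset_involutions s : s \in I ->
  I :&: (N :* s) \subset [set n * s | n in [set n in N :&: N :^ s | n ^ s == n^-1]].
Proof.
move=> Is; have ss := inv_invg (I2 Is).
apply/subsetP=> u /setIP[Iu /rcosetP[n Nn def_u]].
apply/imsetP; exists n => //.
have nsn : n ^ s = n^-1.
  have : u * u = 1 by case/order2P: (I2 Iu).
  by rewrite def_u conjgE ss => /eqP; rewrite -!mulgA -eq_invg_mul => /eqP->.
by rewrite inE in_setI Nn mem_conjg ss nsn groupV Nn eqxx.
Qed.

Lemma card_coset_involutions_le s : s \in I -> s \notin N ->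
  #|I :&: (N :* s)| <= p.
Proof.
move=> Is nNs; have [_ Gs] := setD1P (IG1 Is).
have [_ dvp] := norm_inter_conj Gs nNs.
apply: leq_trans (subset_leq_card (sub_coset_involutions Is)) _.
apply: leq_trans (leq_imset_card _ _) _.
apply: leq_trans (_ : #|N :&: N :^ s| <= _).
  by apply/subset_leq_card/subsetP=> n; rewrite inE => /andP[].
by apply: dvdn_leq; rewrite ?prime_gt0.
Qed.

(* Each coset of N other than N contains at most p involutions, and p on average. *)
Lemma card_coset_involutions h : h \in G -> h \notin N -> #|I :&: (N :* h)| = p.
Proof.
move=> Gh nNh; pose f (D : {set gT}) := #|I :&: D|.
have le_f D : D \in rcosets N G :\ (N : {set gT}) -> f D <= p.
  case/setD1P=> nDN /rcosetsP[g Gg defD]; rewrite /f defD.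
  have [-> | [s /setIP[Is Ds]]] := set_0Vmem (I :&: N :* g); first by rewrite cards0.
  rewrite -(rcoset_eqP Ds) card_coset_involutions_le //.
  apply: contra nDN => Ns; rewrite defD -(rcoset_eqP Ds) rcoset_id //.
have sum_f : \sum_(D in rcosets N G :\ (N : {set gT})) f D
    = \sum_(D in rcosets N G :\ (N : {set gT})) p.
  have NNG : (N : {set gT}) \in rcosets N G.
    by apply/rcosetsP; exists 1; rewrite ?group1 ?mulg1.
  have : \sum_(D in rcosets N G) f D = \sum_(D in rcosets N G) p.
    rewrite sum_nat_const -/(indexg _ _) mulnC.
    rewrite [(p * _)%N](_ : _ = #|I|); last first.
      by rewrite card_involutions -(Lagrange_index sNG (normal_sub nsAN)) mulnC.
    have sIG : I \subset G by apply/subsetP=> s /IG1/setD1P[].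
    rewrite -[in RHS](setIidPr sIG) -sum1_card.
    rewrite [RHS](eq_bigl (fun x => (x \in G) && (x \in I))).
      rewrite big_mkcondr (set_partition_big _ (rcosets_partition sNG)) /=.
      by apply: eq_bigr => D _; rewrite -big_mkcondr /f -sum1_card; apply: eq_bigl => x;
        rewrite inE andbC.
    by move=> x; rewrite inE.
  rewrite (big_setD1 _ NNG) [in RHS](big_setD1 _ NNG) /=.
  have -> : f N = p.
    rewrite -card_involutions_cent; apply: eq_card => s; rewrite [LHS]in_setI [RHS]in_setI.
    apply: andb_id2l => Is; apply/idP/idP; first exact: (involution_norm_cent Is).
    by apply/subsetP; exact: normal_sub nsAN.
  exact: addnI.
rewrite -/(f (N :* h)).
have Dh : N :* h \in rcosets N G :\ (N : {set gT}).
    rewrite in_setD1; apply/andP; split; last by apply/rcosetsP; exists h.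
    by apply: contra nNh => /eqP <-; exact: rcoset_refl.
  have := sum_f; rewrite (big_setD1 _ Dh) [in RHS](big_setD1 _ Dh) /=.
  move/eqP; rewrite eqn_leq => /andP[_ le_sum]; apply/eqP.
  rewrite eqn_leq le_f //=
    -(leq_add2r (\sum_(D in (rcosets N G :\ (N : {set gT})) :\ (N :* h)) p)).
  apply: leq_trans le_sum _; rewrite leq_add2l.
  by apply: leq_sum => D /setD1P[_ /le_f].
Qed.

(** The p involutions of N s give p inverted elements in a group of order at most p. *)
Lemma involution_inverts s : s \in I -> s \notin N ->
  #|N :&: N :^ s| = p /\ {in N :&: N :^ s, forall x, x ^ s = x^-1}.
Proof.
move=> Is nNs; have [_ Gs] := setD1P (IG1 Is).
have [_ dvp] := norm_inter_conj Gs nNs.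
set Z := [set n in N :&: N :^ s | n ^ s == n^-1].
have sZ : Z \subset N :&: N :^ s by apply/subsetP=> n; rewrite inE => /andP[].
have pZ : p <= #|Z|.
  rewrite -(card_coset_involutions Gs nNs).
  apply: leq_trans (subset_leq_card (sub_coset_involutions Is)) _.
  exact: leq_imset_card.
have leX : #|N :&: N :^ s| <= p by apply: dvdn_leq; rewrite ?prime_gt0.
have defZ : Z = N :&: N :^ s.
  by apply/eqP; rewrite eqEcard sZ (leq_trans leX).
split; first by apply/eqP; rewrite eqn_leq leX -defZ.
by move=> x; rewrite -defZ inE => /andP[_ /eqP].
Qed.

Lemma exists_involution_notin : exists2 s, s \in I & s \notin N.
Proof.
have [_ [h Gh nNh]] := properP (properN G1t).
have /card_gt0P[s /setIP[Is hs]] : 0 < #|I :&: N :* h|.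
  by rewrite card_coset_involutions ?prime_gt0.
exists s => //; apply: contra nNh => Ns.
by rewrite -(rcoset_id Ns) -rcoset_sym.
Qed.

(** Comparing orders, C(x) meets N in X. If c in C(x) is outside N, an involution u = n c of N c
    inverts x, and so does n; then x^-2 = [x, n] lies in A, which meets C(x) trivially, although p
    is odd. *)
Lemma inter_cent1 s x : s \in I -> s \notin N -> x \in (N :&: N :^ s)^# ->
  'C_G[x] = N :&: N :^ s.
Proof.
move=> Is nNs Xx; have [cardX invX] := involution_inverts Is nNs.
have [_ Gs] := setD1P (IG1 Is); have [x1 X_x] := setD1P Xx.
have [tiA _] := norm_inter_conj Gs nNs.
have [Nx _] := setIP X_x; have Gx := subsetP sNG x Nx.
pose X := (N :&: N :^ s)%G.
have cyX : cyclic X by apply: prime_cyclic; rewrite cardX.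
have sXG : X \subset G by apply: subset_trans sNG; exact: subsetIl.
have sXC : X \subset 'C_G[x].
  by rewrite subsetI sXG sub_cent1 (subsetP (cyclic_abelian cyX)).
have xx : x * x != 1.
  apply/eqP => xx; have x2 : #[x] == 2 by apply/order2P.
  have := order_dvdG X_x; rewrite cardX (eqP x2) dvdn2.
  by rewrite index_cent_odd.
have tiCA c : c \in 'C_G[x] -> c \in A -> c = 1.
  move=> /setIP[Gc cxc] Ac; apply/eqP; apply: contraNT x1 => c1.
  have Ac1 : c \in A^# by rewrite in_setD1 c1.
  have Ax : x \in A by rewrite -(CA Ac1) inE Gx cent1C.
  by rewrite -in_set1 -[[set 1]]tiA inE Ax; case/setIP: X_x.
have CN : 'C_G[x] :&: N = X.
  apply/esym/eqP; rewrite eqEcard subsetI sXC subsetIl /= cardX.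
  have tiACN : A :&: ('C_G[x] :&: N) = 1.
    by apply/trivgP/subsetP=> c /setIP[Ac /setIP[Cc _]]; rewrite inE (tiCA c).
  rewrite -(leq_pmul2l (cardG_gt0 A)) -(TI_cardMg tiACN) Lagrange ?normal_sub //.
  by apply: subset_leq_card; apply: mul_subG; [exact: normal_sub | exact: subsetIr].
apply/eqP; rewrite eqEsubset sXC andbT; apply/subsetP=> c Cc.
have [Gc cxc] := setIP Cc.
have [Nc|nNc] := boolP (c \in N); first by rewrite -[_ :&: _]CN inE Cc.
have /card_gt0P[u /setIP[Iu Ncu]] : 0 < #|I :&: N :* c|.
  by rewrite card_coset_involutions ?prime_gt0.
have [n Nn def_u] := rcosetP Ncu.
have nNu : u \notin N by rewrite def_u groupMl.
have [_ invU] := involution_inverts Iu nNu.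
have xc : x ^ c = x by apply/conjg_fixP/commgP/cent1P; rewrite cent1C.
have Nux : x \in N :^ u.
  by rewrite def_u conjsgM (conjGid Nn) mem_conjg -{1}xc conjgK.
have xu : x ^ u = x^-1 by apply: invU; rewrite inE Nx.
have xn : x ^ n = x^-1.
  have -> : n = u * c^-1 by rewrite def_u mulgK.
  by rewrite conjgM xu conjVg -{1}xc conjgK.
case/eqP: xx; apply: tiCA.
  by rewrite groupM // inE Gx cent1id.
have : [~ x, n] \in A.
  have abNA : abelian (N / A).
    by apply: cyclic_abelian; apply: prime_cyclic; rewrite card_quotient ?normal_norm.
  apply: subsetP (mem_commg Nx Nn).
  by rewrite der1_min ?normal_norm.
by rewrite commgEl xn -invMg groupV.
Qed.

Lemma card_norm_cent : #|N| = (#|A| * p)%N.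
Proof. by rewrite Lagrange ?normal_sub. Qed.

Lemma inter_Sylow s : s \in I -> s \notin N -> p.-Sylow(N) (N :&: N :^ s).
Proof.
move=> Is nNs; have [cardX _] := involution_inverts Is nNs.
rewrite /pHall subsetIl /pgroup cardX pnat_id //=.
rewrite -divgS ?subsetIl //= cardX card_norm_cent mulnK ?prime_gt0 //.
by rewrite p'natE // -prime_coprime // coprime_sym coprime_cent_index.
Qed.

Lemma card_involutions_norm : #|I| = (p * #|G : N|)%N.
Proof. by rewrite card_involutions -(Lagrange_index sNG (normal_sub nsAN)) mulnC. Qed.

Lemma card_involutions_notin : (#|I :\: N| + p = p * #|G : N|)%N.
Proof.
rewrite -card_involutions_norm -(cardsID N I) addnC; congr (_ + _).
rewrite -card_involutions_cent; apply: eq_card => s; rewrite [LHS]in_setI [RHS]in_setI.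
apply: andb_id2l => Is; apply/idP/idP; last exact: (involution_norm_cent Is).
by apply/subsetP; exact: normal_sub nsAN.
Qed.

(** To an involution s outside N corresponds the Sylow subgroup X s of N, one of at most |A|. Two
    involutions with the same image both invert it, so their product centralizes it and lies in it:
    fibres have at most p members. *)
Lemma index_norm_cent_le : #|G : N| <= #|A|.+1.
Proof.
rewrite -(leq_pmul2l (prime_gt0 p_pr)) -card_involutions_notin mulnS addnC leq_add2l.
pose X s := (N :&: N :^ s)%G.
rewrite -sum1_card (partition_big X (mem 'Syl_p(N))) /=; last first.
  by move=> s /setDP[Is nNs]; rewrite inE inter_Sylow.
have [s0 Is0 nNs0] := exists_involution_notin.
have cardSyl : #|'Syl_p(N)| <= #|A|.
  rewrite (card_Syl (inter_Sylow Is0 nNs0)).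
  have [cardX _] := involution_inverts Is0 nNs0.
  have -> : #|A| = #|N : N :&: N :^ s0|.
    by rewrite -divgS ?subsetIl //= cardX card_norm_cent mulnK ?prime_gt0.
  by apply: dvdn_leq => //; apply: indexgS; rewrite subsetI subsetIl normG.
apply: leq_trans (_ : \sum_(Y in 'Syl_p(N)) p <= _); last first.
  by rewrite sum_nat_const mulnC leq_mul2l cardSyl orbT.
apply: leq_sum => Y _; rewrite sum1dep_card.
have [-> | [s]] := set_0Vmem [set s in I :\: N | X s == Y]; first by rewrite cards0.
case/setIdP=> /setDP[Is nNs] /eqP XsY.
have [cardX invX] := involution_inverts Is nNs.
rewrite -[leqRHS]cardX -[leqRHS](card_lcoset _ s); apply/subset_leq_card/subsetP=> u.
rewrite in_set => /andP[/setDP[Iu nNu] /eqP XuY].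
have eqX : N :&: N :^ u = N :&: N :^ s by rewrite -[LHS]/(gval (X u)) XuY -XsY.
have /trivgPn[x Xx x1] : N :&: N :^ s != 1.
  by rewrite -cardG_gt1 cardX prime_gt1.
have X1x : x \in (N :&: N :^ s)^# by rewrite in_setD1 x1.
have [_ invU] := involution_inverts Iu nNu.
have xu : x ^ u = x^-1 by rewrite invU // eqX.
have [[_ Gs] [_ Gu]] := (setD1P (IG1 Is), setD1P (IG1 Iu)).
rewrite mem_lcoset (inv_invg (I2 Is)) -(inter_cent1 Is nNs X1x) inE groupM //=.
rewrite cent1C; apply/cent1P/commgP/conjg_fixP.
by rewrite conjgM invX // conjVg xu invgK.
Qed.

(** The cosets N s u with u in A are distinct because A meets N^s trivially, and none of them is
    N. *)
Lemma index_norm_cent : #|G : N| = #|A|.+1.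
Proof.
apply/eqP; rewrite eqn_leq index_norm_cent_le /=.
have [s Is nNs] := exists_involution_notin.
have [_ Gs] := setD1P (IG1 Is); have [tiA _] := norm_inter_conj Gs nNs.
have NNG : (N : {set gT}) \in rcosets N G.
  by apply/rcosetsP; exists 1; rewrite ?group1 ?mulg1.
rewrite /indexg (cardsD1 (N : {set gT})) NNG ltnS.
rewrite -(card_in_imset (_ : {in A &, injective (fun u => N :* (s * u))})).
  apply/subset_leq_card/subsetP=> _ /imsetP[u Au ->]; rewrite in_setD1; apply/andP; split.
    apply: contra nNs => /eqP Nsu; have : s * u \in N by rewrite -Nsu rcoset_refl.
    by rewrite groupMr // (subsetP (normal_sub nsAN)).
  by apply/rcosetsP; exists (s * u); rewrite // groupM // (subsetP sAG).
move=> u v Au Av /= eqN; apply/eqP; rewrite eq_mulgV1 -in_set1 -[[set 1]]tiA.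
rewrite inE groupM ?groupV //=.
have : s * u \in N :* (s * v) by rewrite -eqN rcoset_refl.
by rewrite mem_rcoset invMg mem_conjg conjgE invgK !mulgA.
Qed.

(** * Pairs of an element and an involution inverting it *)

Definition inverters d := [set s in I | d ^ s == d^-1].
Local Notation J := inverters.
Local Notation CC d := (class_support 'C_G[d]^# G).

Lemma invertersJ d g : g \in G -> J (d ^ g) = J d :^ g.
Proof.
move=> Gg; apply/setP=> s; rewrite mem_conjg !inE groupJr ?groupV // orderJ.
congr (_ && _); rewrite -[in RHS](inj_eq (conjg_inj g)) -conjgM.
by rewrite conjgCV conjgM conjVg.
Qed.

(** An involution s inverts d exactly when (s d)^2 = 1, so s d is 1 or an involution. *)
Lemma sum_inverters : \sum_(d in G) #|J d| = (#|I| * #|I|.+1)%N.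
Proof.
under eq_bigr do rewrite -sum1_card.
rewrite (exchange_big_dep (mem I)) /=; last by move=> d s _; rewrite inE => /andP[].
rewrite -sum_nat_const; apply: eq_bigr => s Is; rewrite sum1dep_card.
have [Gs ss] := (proj2 (setD1P (IG1 Is)), inv_invg (I2 Is)).
have -> : #|I|.+1 = #|1 |: I| by rewrite cardsU1 inE order1 andbF.
rewrite -[RHS](card_lcoset (1 |: I) s); apply: eq_card => d.
rewrite mem_lcoset ss in_setU1 [LHS]inE [s \in J d]inE Is /= conjg_invE ?I2 //.
rewrite [_ \in I]inE groupMl //.
have [sd1 | sd1] := eqVneq (s * d) 1.
  by rewrite -(groupMl _ Gs) sd1 mulg1 eqxx group1.
by congr (_ && _); apply/eqP/order2P => [|[]].
Qed.

(** For c in C(d), s fixes c c^s. Were this nontrivial, its centralizer C(d) would contain s, which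
    would both fix and invert d. *)
Lemma inverters_cent1 d s : d \in G^# -> d \notin I -> s \in J d ->
  s \notin 'C_G[d] /\ {in 'C_G[d], forall c, c ^ s = c^-1}.
Proof.
move=> G1d nId; rewrite inE => /andP[Is /eqP ds].
have [d1 Gd] := setD1P G1d; have [_ Gs] := setD1P (IG1 Is).
have ss := inv_invg (I2 Is).
have nsC : s \notin 'C_G[d].
  apply: contra nId => /setIP[_ cds]; rewrite inE Gd; apply/order2P; split=> //.
  have : d ^ s = d by apply/conjg_fixP/commgP/cent1P; rewrite cent1C.
  by rewrite ds => {1}<-; rewrite mulVg.
have nCs : s \in 'N('C_G[d]).
  by apply/normP; rewrite conjIg conjGid // -cent1J ds -!cent_cycle cycleV.
split=> // c Cc; have Ccs : c ^ s \in 'C_G[d] by rewrite memJ_norm.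
have cc : c * c ^ s = c ^ s * c by apply: (centsP (caG G1d)).
have fix_s : (c * c ^ s) ^ s = c * c ^ s.
  by rewrite conjMg -conjgM -{2}ss mulVg conjg1 cc.
apply/eqP; rewrite eq_sym eq_invg_mul; apply: contraNT nsC => c1.
have C1 : c * c ^ s \in 'C_G[d]^# by rewrite in_setD1 c1 groupM.
rewrite -(cent1_CA caG G1d C1) inE Gs cent1C.
by apply/cent1P/commgP/conjg_fixP.
Qed.

Lemma card_inverters d : d \in G^# -> d \notin I -> J d != set0 ->
  #|J d| = #|'C_G[d]|.
Proof.
move=> G1d nId /set0Pn[s Js]; have [nsC invC] := inverters_cent1 G1d nId Js.
move: Js; rewrite inE => /andP[Is /eqP ds].
have [d1 Gd] := setD1P G1d; have [_ Gs] := setD1P (IG1 Is).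
have ss := inv_invg (I2 Is); have [s1 sqs] := order2P _ (I2 Is).
rewrite -(card_lcoset 'C_G[d] s); apply: eq_card => u; rewrite mem_lcoset ss.
apply/idP/idP=> [|Csu].
  rewrite inE => /andP[Iu /eqP du]; have [_ Gu] := setD1P (IG1 Iu).
  rewrite inE groupM // cent1C; apply/cent1P/commgP/conjg_fixP.
  by rewrite conjgM ds conjVg du invgK.
have def_u : u = s * (s * u) by rewrite mulgA sqs mul1g.
have Gsu : s * u \in G by case/setIP: Csu.
rewrite inE; apply/andP; split.
  rewrite inE -(groupMl _ Gs) Gsu; apply/order2P; split.
    apply: contra nsC => /eqP u1; rewrite u1 mulg1 in Csu; exact: Csu.
  by apply/eqP; rewrite def_u -conjg_invE ?I2 // invC.
have -> : d ^ u = (d ^ s) ^ (s * u) by rewrite -conjgM -def_u.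
rewrite ds conjVg; apply/eqP; congr _^-1.
by apply/conjg_fixP/commgP/cent1P; rewrite cent1C; case/setIP: Csu.
Qed.

Lemma class_inverters d s y (D := 'C_G[d]) : d \in G^# -> d \notin I -> s \in J d ->
  y \in CC d -> #|J y| = #|D|.
Proof.
move=> G1d nId Js /imset2P[c g Dc Gg ->]; rewrite invertersJ // cardJg.
have [nsC invC] := inverters_cent1 G1d nId Js.
have CcD := cent1_CA caG G1d Dc; have [c1 Cc] := setD1P Dc.
have [Is _] := setIdP Js.
have G1c : c \in G^# by rewrite in_setD1 c1; case/setIP: Cc.
have cs := invC c Cc.
rewrite card_inverters ?CcD //; last by apply/set0Pn; exists s; rewrite inE Is cs eqxx.
apply: contra nsC => Ic; rewrite -CcD inE (proj2 (setD1P (IG1 Is))) cent1C.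
by apply/cent1P/commgP/conjg_fixP; rewrite cs inv_invg ?I2.
Qed.

(** The image of s has order 2 in N(D) / D, which has prime order; so |N(D) : D| = 2. *)
Lemma card_class_inverters d s (D := 'C_G[d]) : d \in G^# -> d \notin I -> s \in J d ->
  (2 * #|D| * #|CC d| = #|D|.-1 * #|G|)%N.
Proof.
move=> G1d nId Js; have [nsC invC] := inverters_cent1 G1d nId Js.
have [Is /eqP ds] := setIdP Js; have [_ Gs] := setD1P (IG1 Is).
have Ns : s \in 'N_G(D).
  rewrite inE Gs; apply/normP; rewrite /D.
  by rewrite conjIg conjGid // -cent1J ds -!cent_cycle cycleV.
have nsDN : C d <| 'N_G(D) by apply: normalSG; exact: subsetIl.
have iD : #|'N_G(D) : D| = 2.
  have pr := primeN G1d.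
  have nDs := subsetP (normal_norm nsDN) s Ns.
  have os : #[coset D s] = 2.
    apply: nt_prime_order => //.
      by rewrite expg2 -morphM // (proj2 (order2P _ (I2 Is))) morph1.
    by apply: contra nsC => /eqP/coset_idr; apply.
  apply/eqP; rewrite eq_sym -(dvdn_prime2 _ pr) // -os.
  by rewrite -card_quotient ?normal_norm // order_dvdG ?mem_quotient.
have cN : #|'N_G(D)| = (2 * #|D|)%N by rewrite -(Lagrange (normal_sub nsDN)) iD mulnC.
have /card_support_normedTI -> := normedTI_cent1 caG G1d.
have -> : #|D^#| = #|D|.-1 by rewrite [#|D|](cardsD1 1) group1.
by rewrite -(Lagrange (subsetIl G 'N(D))) cN mulnCA.
Qed.

(* Y consists of the elements lying neither in a conjugate of A nor in one of the
   subgroups of order p.  An element of Y inverted by an involution is inverted by at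
   most p + 2 of them, whereas the total number of such pairs is |G| (p + 1) / 2. *)
Lemma card_cent_even : #|A| = p.+1.
Proof.
have cardG : (#|G| = #|A|.+1 * (#|A| * p))%N.
  by rewrite -(Lagrange sNG) index_norm_cent card_norm_cent mulnC.
have sIA : I :&: A \subset A^#.
  by apply/subsetP=> s /setIP[Is As]; rewrite in_setD1 As (proj1 (setD1P (IG1 Is))).
have cardA1 : #|A^#| = #|A|.-1 by rewrite [#|A|](cardsD1 1) group1.
apply/eqP; rewrite eqn_leq andbC; apply/andP; split.
  by rewrite -card_involutions_cent -(prednK (cardG_gt0 A)) ltnS -cardA1 subset_leq_card.
have [s0 Is0 nNs0] := exists_involution_notin.
have [cardX invX] := involution_inverts Is0 nNs0.
have /trivgPn[x Xx x1] : N :&: N :^ s0 != 1 by rewrite -cardG_gt1 cardX prime_gt1.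
have Cx : 'C_G[x] = N :&: N :^ s0 by apply: inter_cent1; rewrite // in_setD1 x1.
have Nx : x \in N by case/setIP: Xx.
have G1x : x \in G^# by rewrite in_setD1 x1 (subsetP sNG).
have Jx : s0 \in J x by rewrite inE Is0 invX /=.
have nIx : x \notin I.
  apply/negP=> /I2/eqP x2; have := order_dvdG Xx.
  by rewrite cardX x2 dvdn2 index_cent_odd.
have sCC d : d \in G^# -> CC d \subset G^#.
  move=> G1d; apply/subsetP=> _ /imset2P[b g /setD1P[b1 /setIP[Gb _]] Gg ->].
  by rewrite in_setD1 conjg_eq1 b1 groupJ.
have CCP d e z : d \in G^# -> e \in G^# -> z \in CC d -> z \in CC e -> d \in CC e.
  move=> G1d G1e zd ze; have G1z := subsetP (sCC d G1d) z zd.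
  have [g Gg Cg] := class_support_cent1P caG G1d G1z zd.
  have [h Gh Ch] := class_support_cent1P caG G1e G1z ze.
  apply/(class_support_cent1P caG G1e G1d).
  by exists (h * g^-1); rewrite ?groupM ?groupV // conjsgM -Ch Cg conjsgK.
have xA : x \notin CC t.
  apply/(class_support_cent1P caG G1t G1x) => -[g Gg eqC].
  have eqA : #|A| = p.
    by have := congr1 (fun B : {set gT} => #|B|) eqC; rewrite cardJg Cx cardX.
  have := coprime_cent_index; rewrite eqA /coprime gcdnn => /eqP p1.
  by have := p_pr; rewrite p1.
pose Y := (G^# :\: CC t) :\: CC x.
have sum_split (f : gT -> nat) : \sum_(d in G) f d =
   (f 1%g + \sum_(d in CC t) f d + \sum_(d in CC x) f d + \sum_(d in Y) f d)%N.
  rewrite (big_setD1 1) //= (big_setID (CC t)) (setIidPr (sCC t G1t)) /=.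
  have sxY : CC x \subset G^# :\: CC t.
    apply/subsetP=> z zx; rewrite in_setD (subsetP (sCC x G1x)) // andbT.
    by apply: contra xA => zt; exact: CCP zx zt.
  by rewrite [X in (_ + (_ + X))%N](big_setID (CC x)) /= (setIidPr sxY) !addnA.
have J1 : #|J 1| = #|I|.
  by apply: eq_card => s; rewrite inE conj1g invg1 eqxx andbT.
have sICC : I \subset CC t.
  apply/subsetP=> s /involution_conj[g Gg <-].
  by apply/imset2P; exists t g => //; exact: At.
(* An involution is inverted by the p involutions commuting with it. Other elements of A^# are not
   inverted at all: the inverting involution would lie in N, hence in the abelian A. *)
have sumt : \sum_(d in CC t) #|J d| = (#|I| * p)%N.
  rewrite (big_setID I) (setIidPr sICC) /= [X in (_ + X)%N]big1 ?addn0.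
    rewrite -sum_nat_const; apply: eq_bigr => s /involution_conj[g Gg <-].
    rewrite invertersJ // cardJg -card_involutions_cent; apply: eq_card => u.
    rewrite inE [RHS]inE inv_invg //; apply: andb_id2l => Iu.
    rewrite inE (proj2 (setD1P (IG1 Iu))) /=.
    rewrite cent1C; apply/eqP/idP=> [/conjg_fixP/commgP tu|/cent1P/commgP/conjg_fixP//].
    exact/cent1P.
  move=> _ /setDP[/imset2P[a g Aa Gg ->] nIag]; apply/eqP; rewrite cards_eq0.
  rewrite invertersJ //; apply/eqP; apply: contraNeq nIag => /set0Pn[s].
  rewrite mem_conjg => /setIdP[]; set u := s ^ _ => Iu /eqP au.
  apply: IJ Gg; have [a1 A_a] := setD1P Aa; have [_ Gu] := setD1P (IG1 Iu).
  have Nu : u \in N by rewrite -(memJA Aa) // au in_setD1 invg_eq1 a1 groupV.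
  have Au := involution_norm_cent Iu Nu.
  have : a ^ u = a by apply/conjg_fixP/commgP; exact: (centsP abA).
  rewrite au inE (subsetP sAG) //= => aV; apply/order2P; split=> //.
  by rewrite -{1}aV mulVg.
have sumx : \sum_(d in CC x) #|J d| = (#|CC x| * p)%N.
  rewrite -sum_nat_const; apply: eq_bigr => d xd.
  by rewrite (class_inverters G1x nIx Jx xd) Cx.
have := sum_inverters; rewrite sum_split J1 sumt sumx => /esym eqs.
have eqc : (2 * p * #|CC x| = p.-1 * #|G|)%N.
  by have := card_class_inverters G1x nIx Jx; rewrite Cx cardX.
have eqg : (#|G| = 1 + #|A|.-1 * #|A|.+1 + #|CC x| + #|Y|)%N.
  have := sum_split (fun _ => 1%N); rewrite !sum1_card => ->.
  have /card_support_normedTI -> := normedTI_cent1 caG G1t.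
  by rewrite -/N index_norm_cent -cardA1.
have eqi : (#|I| = p * #|A|.+1)%N by rewrite card_involutions_norm index_norm_cent.
have eqsum : (2 * \sum_(d in Y) #|J d| = p.+1 * #|G|)%N.
  exact: even_CA_sum (prime_gt0 p_pr) eqi cardG eqc eqs.
apply: even_CA_arith (prime_gt0 p_pr) (cardG_gt0 A) eqi cardG eqc eqs eqg _.
rewrite -mulnA leq_mul2l /= mulnC -sum_nat_const; apply: leq_sum => d Yd.
have [-> | ntJ] := eqVneq (J d) set0; first by rewrite cards0.
have [/setDP[G1d td] xd] := setDP Yd.
have nId : d \notin I by apply: contra td; exact: (subsetP sICC).
have /set0Pn[s Js] := ntJ.
rewrite card_inverters //.
(* The nontrivial elements of the conjugates of C(d) lie in [Y], and each is inverted by |C(d)|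
   involutions; this part cannot exceed the known sum over [Y]. *)
have : #|'C_G[d]|.-1 * #|G| <= p.+1 * #|G|.
  rewrite -eqsum -(card_class_inverters G1d nId Js) -mulnA leq_mul2l /=.
  have sdY : CC d \subset Y.
    apply/subsetP=> z zd; apply/setDP; split; last first.
      by apply: contra xd => zx; exact: CCP zd zx.
    apply/setDP; split; first exact: subsetP (sCC d G1d) z zd.
    by apply: contra td => zt; exact: CCP zd zt.
  rewrite (big_setID (CC d)) /= (setIidPr sdY) mulnC -sum_nat_const.
  rewrite (eq_bigr (fun z => #|J z|)) ?leq_addr // => z zd.
  by rewrite (class_inverters G1d nId Js zd).
rewrite leq_pmul2r ?cardG_gt0 // -subn1 leq_subLR add1n => leC.
by rewrite addnC.
Qed.

Lemma card_even_CA : (#|G| = p.+2 * (p.+1 * p))%N.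
Proof.
by rewrite -(Lagrange sNG) index_norm_cent card_norm_cent card_cent_even mulnC.
Qed.

End EvenCA.

(** * Proper subgroups are metabelian *)

Section FiniteYn.

Variable gT : finGroupType.
Implicit Types F K : {group gT}.

Lemma Yn_nonmetabelian_card F t (A := 'C_F[t]) : Yn F -> ~~ abelian F^`(1) ->
    t \in F -> #[t] == 2 -> let p := #|'N_F(A) : A| in
  [/\ CA_group F, prime p & (#|F| = p.+2 * (p.+1 * p))%N].
Proof.
move=> YF nmF Ft t2 p; have [simF locF] := Yn_nonmetabelian YF nmF.
have nabF : ~~ abelian F by apply: contra nmF => abF; rewrite (derG1P abF) abelian1.
have caF := CA_group_Yn YF simF nabF locF.
have prF := cent1_index_prime YF simF nabF locF.
have properN : {in F^#, forall x, 'N_F('C_F[x]) \proper F}.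
  move=> x F1x; have [x1 Fx] := setD1P F1x.
  rewrite properEneq subsetIl andbT; apply/eqP => NF.
  have nsC : 'C_F[x] <| F by rewrite /normal subsetIl -{1}NF subsetIr.
  have C1 := simple_normal simF nsC (caF x F1x) nabF.
  by case/eqP: x1; apply/set1P; rewrite -[[set 1]]C1 inE Fx cent1id.
have F1t : t \in F^# by rewrite in_setD1 Ft andbT; case/order2P: t2.
split; [exact: caF | exact: prF |].
exact: card_even_CA caF prF properN Ft t2.
Qed.

Lemma Yn_nonmetabelian_even F : Yn F -> ~~ abelian F^`(1) -> ~~ odd #|F|.
Proof.
move=> YF nmF; apply: contra nmF => oddF; apply/idPn => nmF.
have [simF locF] := Yn_nonmetabelian YF nmF.
have nabF : ~~ abelian F by apply: contra nmF => abF; rewrite (derG1P abF) abelian1.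
have caF := CA_group_Yn YF simF nabF locF.
have perfF := Yn_der1 YF nmF.
case/negP: nabF.
by rewrite (odd_CA_perfect oddF caF perfF) abelian1.
Qed.

(** A nonmetabelian K contains an involution t, and the orders of K and F are given by the index
    primes of C(t). N_K(B) / B embeds in N_F(A) / A, so the primes agree and |K| = |F|. *)
Lemma Yn_proper_metabelian F K : Yn F -> K \proper F -> abelian K^`(1).
Proof.
move=> YF prK; apply: contraLR prK => nmK; rewrite properE negb_and negbK.
have [sKF /=|//] := boolP (K \subset F).
have YK := Yn_sub YF sKF.
have nmF : ~~ abelian F^`(1) by apply: contra nmK; apply: abelianS; exact: dergS.
have := Yn_nonmetabelian_even YK nmK; rewrite -dvdn2 => dv2.
have [t Kt t2] := Cauchy (isT : prime 2) dv2.
have Ft := subsetP sKF t Kt; have t2b : #[t] == 2 by rewrite t2.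
have [caF pF cF] := Yn_nonmetabelian_card YF nmF Ft t2b.
have [caK pK cK] := Yn_nonmetabelian_card YK nmK Kt t2b.
set A := 'C_F[t] in pF cF; set B := 'C_K[t] in pK cK.
have F1t : t \in F^# by rewrite in_setD1 Ft andbT; case/order2P: t2b.
have Bt : t \in B by rewrite inE Kt cent1id.
have [_ _ memJ] := normedTI_memJ_P (normedTI_cent1 caF F1t).
have sNN : 'N_K(B) \subset 'N_F(A).
  apply/subsetP=> n /setIP[Kn nBn]; have Fn := subsetP sKF n Kn.
  rewrite -(memJ t) //; last first.
    by rewrite in_setD1 (proj1 (setD1P F1t)) inE Ft cent1id.
  rewrite in_setD1 conjg_eq1 (proj1 (setD1P F1t)) /=.
  have : t ^ n \in B by rewrite memJ_norm.
  by apply: subsetP; exact: setSI.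
have nsA : A <| 'N_F(A) by apply: normalSG; exact: subsetIl.
have nsB : B <| 'N_K(B) by apply: normalSG; exact: subsetIl.
have NBA : A :&: 'N_K(B) = B.
  apply/eqP; rewrite eqEsubset subsetI (setSI _ sKF) (normal_sub nsB) !andbT.
  by apply/subsetP=> x /setIP[/setIP[_ cx] /setIP[Kx _]]; rewrite inE Kx.
have dv : #|'N_K(B) : B| %| #|'N_F(A) : A|.
  have nAN := subset_trans sNN (normal_norm nsA).
  have -> : #|'N_K(B) : B| = #|'N_K(B) / A|.
    by rewrite -(card_isog (second_isog nAN)) NBA card_quotient ?normal_norm.
  by rewrite -card_quotient ?normal_norm // cardSg // quotientS.
have eqp : #|'N_K(B) : B| = #|'N_F(A) : A| by apply/eqP; rewrite -dvdn_prime2.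
have : K :==: F by rewrite eqEcard sKF cF cK eqp leqnn.
by rewrite eqEsubset => /andP[].
Qed.

End FiniteYn.

From mathcomp Require Import boolp.

(** * From the group record to finite groups *)

Section GroupRecord.

Variable G : Group.
Implicit Types x y z : G.

Lemma gmulV x : gmul x (ginv x) = gone.
Proof.
rewrite -[gmul x (ginv x)]gmul_1l -(gmul_Vl _ (ginv x)) -gmul_assoc.
by rewrite [gmul (ginv x) (gmul _ _)]gmul_assoc gmul_Vl gmul_1l.
Qed.

Lemma gmul_1r x : gmul x gone = x.
Proof. by rewrite -(gmul_Vl _ x) gmul_assoc gmulV gmul_1l. Qed.

Lemma gmul_injl x y z : gmul x y = gmul x z -> y = z.
Proof.
by move/(congr1 (gmul (ginv x))); rewrite !gmul_assoc gmul_Vl !gmul_1l.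
Qed.

Lemma gen_set_subgroup (S : G -> Prop) : is_subgroup G (gen_set G S).
Proof.
split; first by move=> H [H1 _] _.
split=> [x y Sx Sy H sH SH | x Sx H sH SH]; have [_ [HM HV]] := sH.
  by apply: HM; [exact: Sx | exact: Sy].
by apply: HV; exact: Sx.
Qed.

Lemma gen_set_mem (S : G -> Prop) x : S x -> gen_set G S x.
Proof. by move=> Sx H _; apply. Qed.

Definition comm_in (H : G -> Prop) z :=
  exists x y, H x /\ H y /\ z = commutator G x y.

(** Only finitely many commutators are involved. Quantifying over all H containing the list allows
    lists to be concatenated for products. *)
Lemma derived_subgroup_finitary x : derived_subgroup G x ->
  exists l : list G, forall H, is_subgroup G H ->
    (forall y, List.In y l -> H y) -> gen_set G (comm_in H) x.
Proof.
move=> dx; pose P z := exists l : list G, forall H, is_subgroup G H ->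
  (forall y, List.In y l -> H y) -> gen_set G (comm_in H) z.
apply: (dx P); last first.
  move=> _ [a [b ->]]; exists [:: a; b] => H _ Hl; apply: gen_set_mem.
  by exists a, b; split; [|split] => //; apply: Hl => /=; auto.
split; first by exists [::] => H sH _; case: (gen_set_subgroup (comm_in H)).
split=> [u v [l1 l1P] [l2 l2P] | u [l lP]].
  exists (List.app l1 l2) => H sH Hl.
  have [_ [HM _]] := gen_set_subgroup (comm_in H).
  by apply: HM; [apply: l1P | apply: l2P] => // y ly; apply: Hl; apply: List.in_or_app; auto.
by exists l => H sH Hl; have [_ [_ HV]] := gen_set_subgroup (comm_in H); apply: HV; exact: lP.
Qed.

End GroupRecord.

Section FiniteModel.

Variables (G : Group) (H : G -> Prop) (s : seq {classic G}).
Hypotheses (sgH : is_subgroup G H) (memH : forall x : G, H x <-> (x : {classic G}) \in s).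

(* Carriers of the record are arbitrary types: {classic G} supplies decidable equality
   and choice. *)
Definition model := seq_sub s.
HB.instance Definition _ := Finite.on model.

Let inH (u : model) : H (val u).
Proof. by apply/memH; exact: valP. Qed.

Definition model_elt x (Hx : H x) : model := SeqSub (proj1 (memH x) Hx).

Definition model_mul (u v : model) : model :=
  model_elt (proj1 (proj2 sgH) _ _ (inH u) (inH v)).
Definition model_one : model := model_elt (proj1 sgH).
Definition model_inv (u : model) : model := model_elt (proj2 (proj2 sgH) _ (inH u)).

Lemma model_mulA : associative model_mul.
Proof. by move=> u v w; apply: val_inj; exact: gmul_assoc. Qed.
Lemma model_mul1 : left_id model_one model_mul.
Proof. by move=> u; apply: val_inj; exact: gmul_1l. Qed.
Lemma model_mulV : left_inverse model_one model_inv model_mul.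
Proof. by move=> u; apply: val_inj; exact: gmul_Vl. Qed.

HB.instance Definition _ :=
  Finite_isGroup.Build model model_mulA model_mul1 model_mulV.

Lemma model_spec : exists (gT : finGroupType) (f : gT -> G),
  [/\ injective f, forall u v, f (u * v) = gmul (f u) (f v) &
      forall x, H x <-> exists u, f u = x].
Proof.
exists model, (fun u : model => val u : G); split=> // [|x]; first exact: val_inj.
split=> [Hx | [u <-]]; last exact: inH.
by exists (model_elt Hx).
Qed.

End FiniteModel.

Lemma finite_subgroup_model (G : Group) (H : G -> Prop) :
    is_subgroup G H -> finite_set G H ->
  exists (gT : finGroupType) (f : gT -> G),
  [/\ injective f, forall u v, f (u * v) = gmul (f u) (f v) &
      forall x, H x <-> exists u, f u = x].
Proof.
(* The list may contain elements outside H, so it is filtered. *)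
move=> sgH [l Hl]; pose s : seq {classic G} := [seq x <- l | `[< H x >]].
apply: (model_spec sgH (s := s)) => x; rewrite mem_filter.
split=> [Hx|/andP[/asboolP]//]; apply/andP; split; first exact/asboolP.
elim: l {s Hl} (Hl x Hx) => //= y l IHl [->|/IHl lx]; rewrite inE ?eqxx //.
by rewrite lx orbT.
Qed.

Section Transfer.

Variables (G : Group) (gT : finGroupType) (f : gT -> G).
Hypotheses (f_inj : injective f) (fM : forall u v, f (u * v) = gmul (f u) (f v)).

Lemma model_f1 : f 1 = gone.
Proof. by apply: (@gmul_injl G (f 1)); rewrite -fM mulg1 gmul_1r. Qed.

Lemma model_fV u : f u^-1 = ginv (f u).
Proof. by apply: (@gmul_injl G (f u)); rewrite -fM mulgV gmulV model_f1. Qed.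

Definition image_pred (K : {set gT}) (x : G) := exists2 u, u \in K & f u = x.

Lemma image_subgroup (K : {group gT}) : is_subgroup G (image_pred K).
Proof.
split; first by exists 1 => //; exact: model_f1.
split=> [_ _ [u Ku <-] [v Kv <-] | _ [u Ku <-]].
  by exists (u * v); rewrite ?groupM ?fM.
by exists u^-1; rewrite ?groupV ?model_fV.
Qed.

Lemma image_pred_f (K : {set gT}) u : image_pred K (f u) <-> u \in K.
Proof. by split=> [[v Kv /f_inj <-]|Ku] //; exists u. Qed.

Lemma in_Yn_model : in_Yn G -> Yn [set: gT]%G.
Proof.
move=> YG K _ nabK; apply/subsetP=> n /setIP[_ nKn].
apply/image_pred_f/(YG _ (image_subgroup K)).
  move=> abK; case/negP: nabK; apply/centsP=> u Ku v Kv; apply: f_inj.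
  by rewrite !fM; apply: abK; apply/image_pred_f.
move=> x; split=> [[u Ku <-]|[u Ku def_u]].
  by exists (u ^ n); rewrite ?memJ_norm // conjgE !fM model_fV.
exists (u ^ n^-1); first by rewrite memJ_norm ?groupV.
rewrite conjgE invgK !fM def_u model_fV !gmul_assoc gmulV gmul_1l.
by rewrite -gmul_assoc gmulV gmul_1r.
Qed.

Lemma image_derived (H : G -> Prop) (K : {group gT}) x :
    (forall y, H y -> image_pred K y) -> gen_set G (comm_in H) x ->
  image_pred K^`(1) x.
Proof.
move=> HK /(_ _ (image_subgroup K^`(1)%G)); apply.
move=> _ [a [b [/HK[u Ku <-] [/HK[v Kv <-] ->]]]].
exists [~ u, v]; first exact: mem_commg.
by rewrite /commg /conjg !fM !model_fV.
Qed.

End Transfer.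

Theorem theorem3p4 (G : Group) :
  infinite_group G -> locally_finite G -> in_Yn G -> metabelian G.
Proof.
move=> infG lfG YG x y /derived_subgroup_finitary[l1 l1P] /derived_subgroup_finitary[l2 l2P].
pose l0 := List.app l1 l2; pose H0 := gen_set G (fun z => List.In z l0).
have sgH0 : is_subgroup G H0 := gen_set_subgroup _.
(* [H0] is finite by local finiteness, and G is infinite. *)
have [g nH0g] : exists g, ~ H0 g.
  apply: contrapT => all0; apply: infG; have [l lP] := lfG l0; exists l => z _.
  by apply: lP; apply: contrapT => nz; apply: all0; exists z.
pose H := gen_set G (fun z => List.In z (g :: l0)).
have [gT [f [f_inj fM memH]]] :=
  finite_subgroup_model (gen_set_subgroup _ : is_subgroup G H) (lfG _).
have sH0H z : H0 z -> H z.
  by move/(_ H (gen_set_subgroup _)); apply=> u lu; apply: gen_set_mem; right.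
pose K := [set u : gT | `[< H0 (f u) >]].
have gK : group_set K.
  apply/group_setP; split.
    by rewrite inE; apply/asboolP; rewrite (model_f1 fM); case: sgH0.
  move=> u v; rewrite !inE => /asboolP Hu /asboolP Hv; apply/asboolP.
  by rewrite fM; have [_ [HM _]] := sgH0; exact: HM.
have H0K z : H0 z -> image_pred f K z.
  move=> H0z; have [u fu] := proj1 (memH z) (sH0H z H0z).
  by exists u; rewrite // inE fu; apply/asboolP.
have prK : group gK \proper [set: gT].
  rewrite properEneq subsetT andbT; apply/eqP=> KT.
  have [u fu] : exists u, f u = g.
    by apply/memH; apply: gen_set_mem; exact: or_introl.
  by have := in_setT u; rewrite -KT inE fu => /asboolP.
(* The copy of [H0] is proper in the finite group generated by [g] and [l0], so its derived subgroup
   is abelian; by the choice of [l1] and [l2] that subgroup contains x and y. *)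
have := Yn_proper_metabelian (in_Yn_model f_inj fM YG) prK.
have derK l z : (forall H1, is_subgroup G H1 -> (forall y, List.In y l -> H1 y) ->
    gen_set G (comm_in H1) z) -> (forall y, List.In y l -> List.In y l0) ->
    image_pred f (group gK)^`(1) z.
  move=> lP sl; apply: (@image_derived _ _ f fM H0 (group gK) z H0K); apply: lP => // v lv.
  by apply: gen_set_mem; exact: sl.
have [u Ku <-] := derK l1 x l1P (fun z lz => List.in_or_app _ _ _ (or_introl lz)).
have [v Kv <-] := derK l2 y l2P (fun z lz => List.in_or_app _ _ _ (or_intror lz)).
by move/centsP=> cK; rewrite -!fM cK.
Qed.
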